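(* For every nonnegative integer $w$, one has the identity of formal power series in $x=(x_1,x_2,\ldots)$ and $y=(y_1,y_2,\ldots)$ with coefficients in $\mathbb Z[\beta]$ $$\sum_{\lambda:\ \lambda_1=w}G_\lambda(\beta,x)\cdot g_\lambda(\beta,y)=\sum_{\lambda:\ \lambda_1=w}s_\lambda(x)\cdot s_\lambda(y),$$ where both sums are over all Young diagrams $\lambda$ whose first row has exactly $w$ boxes.
   Context: A Young diagram $\lambda=(\lambda_1\ge\lambda_2\ge\cdots)$ is identified with its finite set of boxes $(i,j)$, $1\le j\le\lambda_i$ (row $i$, column $j$). For a sequence $\alpha$ write $x^\alpha=x_1^{\alpha_1}x_2^{\alpha_2}\cdots$. $\mathcal S_\lambda$ is the set of integer-valued column-strict tableaux of shape $\lambda$: fillings by positive integers, strictly increasing down columns and weakly increasing along rows. $s_\lambda(x)=\sum_{T\in\mathcal S_\lambda}x^{\mu(T)}$, where $\mu(T)_k$ is the number of boxes of $T$ containing $k$ (Schur function). $\mathcal P_\lambda$ is the set of set-valued column-strict tableaux $P$ of shape $\lambda$: each $P_{i,j}$ is a nonempty finite set of positive integers, with $\max P_{i,j}<\min P_{i',j}$ for $i<i'$ and $\max P_{i,j}\le\min P_{i,j'}$ for $j<j'$. $\varepsilon(P)=\sum_{(i,j)\in\lambda}(|P_{i,j}|-1)$, $\mu(P)_k=|\{(i,j)\in\lambda:k\in P_{i,j}\}|$, and $G_\lambda(\beta,x)=\sum_{P\in\mathcal P_\lambda}(-\beta)^{\varepsilon(P)}x^{\mu(P)}$. $\mathcal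 Q_\lambda$ is the set of reverse plane partitions $Q$ of $\lambda$: fillings by positive integers, weakly increasing along rows and down columns. $\delta(Q)=|\{(i,j)\in\lambda:(i+1,j)\in\lambda,\ Q_{i,j}=Q_{i+1,j}\}|$, $\nu(Q)_k$ is the number of columns of $Q$ containing $k$, and $g_\lambda(\beta,y)=\sum_{Q\in\mathcal Q_\lambda}\beta^{\delta(Q)}y^{\nu(Q)}$. *)

(* Defs.v *)
From HB Require Import structures.
From mathcomp Require Import all_boot all_order all_algebra finmap.
From mathcomp Require Import boolp classical_sets functions cardinality fsbigop.

Set Implicit Arguments.
Unset Strict Implicit.
Unset Printing Implicit Defensive.
Import GRing.Theory.
Local Open Scope classical_set_scope.
Local Open Scope ring_scope.

(** ** Formal power series over Z[beta], with [beta := 'X] in [{poly int}]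

    Variables and tableau entries are indexed from 0: an entry [k : nat] stands
    for the positive integer [k+1], and contributes the variable [x_{k+1}]. *)

Definition monomial : choiceType := {fsfun nat -> nat with 0%N}.

(* A series in x maps alpha to the coefficient of x^alpha; a series in x and y
   maps alpha, gamma to the coefficient of x^alpha y^gamma. *)
Definition series := monomial -> {poly int}.
Definition series2 := monomial -> monomial -> {poly int}.

Definition mone : monomial := [fsfun for fun=> 0%N].

Definition in_x (F : series) : series2 :=
  fun a b => if b == mone then F a else 0.
Definition in_y (F : series) : series2 :=
  fun a b => if a == mone then F b else 0.

Definition splits (a : monomial) : set (monomial * monomial) :=
  [set p : monomial * monomial | forall k, (p.1 k + p.2 k)%N = a k].

Definition mul2 (F H : series2) : series2 := fun a b =>
  \sum_(p \in splits a) \sum_(q \in splits b) F p.1 q.1 * H p.2 q.2.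

(* Infinite sums are taken coefficientwise. [\sum_(t \in A) f t] is the sum of
   [f] over its support in [A], and 0 by convention if that support is
   infinite; the latter never happens below, see [finite_has_weight_*] and
   [finite_shapes] at the end. *)
Definition sum2 (T : choiceType) (A : set T) (F : T -> series2) : series2 :=
  fun a b => \sum_(t \in A) F t a b.

Definition has_weight (T : Type) (wt : T -> nat -> nat) (a : monomial) : set T :=
  [set t | forall k, wt t k = a k].

(* The series sum_(t in A) c(t) x^(wt t). *)
Definition genfun (T : choiceType) (A : set T) (c : T -> {poly int})
    (wt : T -> nat -> nat) : series :=
  fun a => \sum_(t \in A `&` has_weight wt a) c t.

(** ** Young diagrams *)

Definition is_diagram (la : seq nat) : bool := sorted geq la && (0%N \notin la).

Definition first_row (la : seq nat) : nat := nth 0%N la 0.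

Definition box (la : seq nat) : finType :=
  {i : 'I_(size la) & 'I_(nth 0%N la i)}.

Definition row (la : seq nat) (b : box la) : nat := tag b.
Definition col (la : seq nat) (b : box la) : nat := tagged b.

(** ** Schur functions *)

Definition is_cst (la : seq nat) (T : {ffun box la -> nat}) : Prop :=
  (forall b c, col b = col c -> (row b < row c)%N -> (T b < T c)%N) /\
  (forall b c, row b = row c -> (col b < col c)%N -> (T b <= T c)%N).

Definition cst_wt (la : seq nat) (T : {ffun box la -> nat}) (k : nat) : nat :=
  #|[pred b : box la | T b == k]|.

Definition schur (la : seq nat) : series :=
  genfun [set T | @is_cst la T] (fun=> 1) (@cst_wt la).

(** ** Stable Grothendieck functions *)

(* On nonempty finite sets these say max A < min B and max A <= min B. *)
Definition fset_lt (A B : {fset nat}) : Prop :=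
  forall k l, k \in A -> l \in B -> (k < l)%N.
Definition fset_le (A B : {fset nat}) : Prop :=
  forall k l, k \in A -> l \in B -> (k <= l)%N.

Definition is_svt (la : seq nat) (P : {ffun box la -> {fset nat}}) : Prop :=
  [/\ forall b, P b != fset0,
      forall b c, col b = col c -> (row b < row c)%N -> fset_lt (P b) (P c)
    & forall b c, row b = row c -> (col b < col c)%N -> fset_le (P b) (P c)].

Definition svt_excess (la : seq nat) (P : {ffun box la -> {fset nat}}) : nat :=
  (\sum_(b : box la) (#|` P b| - 1))%N.

Definition svt_wt (la : seq nat) (P : {ffun box la -> {fset nat}}) (k : nat) :
    nat :=
  #|[pred b : box la | k \in P b]|.

Definition grothendieck (la : seq nat) : series :=
  genfun [set P | @is_svt la P] (fun P => (- 'X) ^+ svt_excess P) (@svt_wt la).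

(** ** Dual stable Grothendieck functions *)

Definition is_rpp (la : seq nat) (Q : {ffun box la -> nat}) : Prop :=
  (forall b c, col b = col c -> (row b < row c)%N -> (Q b <= Q c)%N) /\
  (forall b c, row b = row c -> (col b < col c)%N -> (Q b <= Q c)%N).

Definition rpp_repeats (la : seq nat) (Q : {ffun box la -> nat}) : nat :=
  #|[pred b : box la | [exists c : box la,
      [&& row c == (row b).+1, col c == col b & Q b == Q c]]]|.

Definition rpp_wt (la : seq nat) (Q : {ffun box la -> nat}) (k : nat) : nat :=
  #|[pred j : 'I_(first_row la) |
      [exists b : box la, (col b == j) && (Q b == k)]]|.

Definition dual_grothendieck (la : seq nat) : series :=
  genfun [set Q | @is_rpp la Q] (fun Q => 'X ^+ rpp_repeats Q) (@rpp_wt la).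

(** ** Sanity checks: the product, and finiteness of all the sums above *)

Lemma mul2_in_x_in_y (F H : series) a b :
  mul2 (in_x F) (in_y H) a b = F a * H b.
Proof.
have m0 k : mone k = 0%N by rewrite /mone fsfun0E.
have sL : splits a (a, mone) by move=> k /=; rewrite m0 addn0.
have sR : splits b (mone, b) by move=> k /=; rewrite m0.
rewrite /mul2 -(fsbig_widen [set (a, mone)] (splits a)); last 2 first.
- by move=> _ ->.
- move=> [p1 p2] [/= sp np]; apply: fsbig1 => -[q1 q2] sq /=.
  rewrite /in_x /in_y /=; case: (eqVneq p2 mone) => [e|_]; last first.
    by rewrite mulr0.
  case: np; rewrite e; congr pair; apply/fsfunP => k.
  by rewrite -(sp k) /= e m0 addn0.
rewrite fsbig_set1 -(fsbig_widen [set (mone, b)] (splits b)); last 2 first.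
- by move=> _ ->.
- move=> [q1 q2] [/= sq nq]; rewrite /in_x /in_y /=.
  case: (eqVneq q1 mone) => [e|_]; last by rewrite mul0r.
  case: nq; rewrite e; congr pair; apply/fsfunP => k.
  by rewrite -(sq k) /= e m0.
by rewrite fsbig_set1 /in_x /in_y /= !eqxx.
Qed.

Lemma finite_ffun (I : finType) (T : choiceType) (X : {fset T}) :
  finite_set [set f : {ffun I -> T} | forall i, f i \in X].
Proof.
pose h (g : {ffun I -> X}) : {ffun I -> T} := [ffun i => val (g i)].
apply: (@sub_finite_set _ _ (range h)); last exact/finite_image/finite_finset.
move=> f fX; exists [ffun i => [` fX i]%fset] => //.
by apply/ffunP => i; rewrite !ffunE.
Qed.

Lemma in_finsupp (a : monomial) k : (0 < a k)%N -> k \in finsupp a.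
Proof. by rewrite mem_finsupp lt0n. Qed.

Lemma finite_has_weight_cst la a : finite_set (has_weight (@cst_wt la) a).
Proof.
apply: sub_finite_set (@finite_ffun (box la) nat (finsupp a)) => T wT b.
by apply: in_finsupp; rewrite -wT; apply/card_gt0P; exists b; rewrite inE.
Qed.

Lemma finite_has_weight_svt la a : finite_set (has_weight (@svt_wt la) a).
Proof.
apply: sub_finite_set
  (@finite_ffun (box la) {fset nat} (fpowerset (finsupp a))) => P wP b.
rewrite fpowersetE; apply/fsubsetP => k kP.
by apply: in_finsupp; rewrite -wP; apply/card_gt0P; exists b; rewrite inE.
Qed.

Lemma col_lt_first_row la (b : box la) :
  is_diagram la -> (col b < first_row la)%N.
Proof.
case/andP => sla _; apply: leq_trans (ltn_ord (tagged b)) _.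
have gT : transitive geq by move=> x y z /= yx zx; apply: leq_trans zx yx.
have := sorted_leq_nth gT leqnn 0%N sla 0%N (tag b).
by apply => //; rewrite inE //; case: (size la) (tag b) => [[]|].
Qed.

Lemma finite_has_weight_rpp la a :
  is_diagram la -> finite_set (has_weight (@rpp_wt la) a).
Proof.
move=> dla.
apply: sub_finite_set (@finite_ffun (box la) nat (finsupp a)) => Q wQ b.
apply: in_finsupp; rewrite -wQ; apply/card_gt0P.
exists (Ordinal (col_lt_first_row b dla)); rewrite inE.
by apply/existsP; exists b; rewrite !eqxx.
Qed.

Lemma card_box la : #|{: box la}| = sumn la.
Proof.
rewrite card_tagged -[in RHS](mkseq_nth 0%N la) /mkseq -val_enum_ord -map_comp.
by congr sumn; apply: eq_map => i /=; rewrite card_ord.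
Qed.

Lemma card_box_le (la : seq nat) (r : box la -> nat -> bool) (a : monomial) :
  (forall b, exists k, r b k) ->
  (forall k, #|[pred b : box la | r b k]| = a k) ->
  (sumn la <= \sum_(k <- finsupp a) a k)%N.
Proof.
move=> rE wr; rewrite -card_box -sum1_card.
under [leqRHS]eq_bigr => k _ do rewrite -wr -sum1_card big_mkcond.
rewrite exchange_big /=; apply: leq_sum => b _; have [k rbk] := rE b.
have ka : k \in finsupp a.
  by apply: in_finsupp; rewrite -wr; apply/card_gt0P; exists b; rewrite inE.
by rewrite (bigD1_seq k) ?fset_uniq //= inE rbk.
Qed.

Lemma finite_diagrams d : finite_set [set la | is_diagram la /\ (sumn la <= d)%N].
Proof.
pose h (t : d.-bseq 'I_d.+1) : seq nat := map val t.
apply: (@sub_finite_set _ _ (range h)); last exact/finite_image/finite_finset.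
move=> la [/andP[_ la0] lad].
have szla : (size (map (@inord d) la) <= d)%N.
  rewrite size_map; apply: leq_trans lad.
  elim: la la0 => //= x la IH; rewrite inE negb_or => /andP[x0 /IH].
  by move=> le; rewrite -add1n leq_add // lt0n eq_sym.
exists (Bseq szla) => //; rewrite /h /= -map_comp -[RHS]map_id.
apply/eq_in_map => x xla /=; rewrite inordK // ltnS; apply: leq_trans lad.
elim: la xla {la0 szla} => //= y la IH; rewrite inE => /predU1P[->|/IH].
  exact: leq_addr.
by move=> le; apply: leq_trans le (leq_addl _ _).
Qed.

Lemma finite_shapes (F : seq nat -> series) (H : seq nat -> series) a b :
  F = grothendieck \/ F = schur ->
  finite_set [set la | is_diagram la /\
    mul2 (in_x (F la)) (in_y (H la)) a b <> 0].
Proof.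
move=> FE; pose d := (\sum_(k <- finsupp a) a k)%N.
apply: sub_finite_set (finite_diagrams d) => la [dla nz]; split => //.
have {}nz : F la a <> 0 by move=> F0; apply: nz; rewrite mul2_in_x_in_y F0 mul0r.
apply: contra_notT nz => big; case: FE => ->; apply: fsbig1 => T [] /=.
- move=> [P0 _ _] wP; case/negP: big.
  by apply: (@card_box_le _ (fun b k => k \in T b)) => // c; apply/fset0Pn.
- move=> _ wT; case/negP: big.
  by apply: (@card_box_le _ (fun b k => T b == k)) => // c; exists (T c).
Qed.

(* Main.v *)
Require Import Defs.
From mathcomp Require Import all_boot all_order all_algebra finmap.
From mathcomp Require Import zify ring.

(** Fix [w] and introduce a parameter [z] specialising to the Grothendieck side
    at [z = beta] and to the Schur side, for both families, at [z = 0]. Peeling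
    off the largest letter writes the two families as sums over chains of
    diagrams, with step weights
      [up_weight]: prod_i x^(la_i - mu_i) (1 - z x)^[la_(i+1) < mu_i] when la/mu
        is a horizontal strip,
      [down_weight]: prod_i y^(la_i - max(mu_i, la_(i+1))) z^(la_(i+1) - mu_i).
    For fixed mu, nu the sum over la of an up step mu -> la followed by a down
    step la -> nu factors over the rows of la, and so does the sum over ka of a
    down step mu -> ka followed by an up step ka -> nu; comparing factors gives
    the skew Cauchy identity, and leaving the first row of la unsummed refines
    it: la_1 behaves as max(mu_1, nu_1) + k with weight (x y)^k, whatever [z] is
    (the last passage percolation recursion). Hence the generating function of
    the first row of the largest diagram does not depend on [z]. *)

Set Implicit Arguments.
Unset Strict Implicit.
Unset Printing Implicit Defensive.
Import GRing.Theory.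
Local Open Scope ring_scope.

(** * Row sums *)

(** The factors of the two row decompositions are not equal: they agree up to monomials in [x] and
    [y] whose quotients telescope over the rows. Removing these monomials takes cancellation, so the
    letters must be nonzero elements of an integral domain. They are therefore not formal variables
    of [series2] but powers of a single indeterminate over [{poly int}], spaced so widely that one
    coefficient of one polynomial recovers the coefficient of x^a y^b. All shapes live in a box of
    [L.+1] rows and [W] columns. The cut at [W] loses nothing, because the identity with the first
    row left open holds for an arbitrary weight of that row. The cut at [L] is compensated by the
    fact that few letters fill few rows. An up step that crosses a whole chain of down steps changes
    the first part of every shape in it, each new value depending on two neighbouring old ones.
    Hence the induction runs over functionals of the full sequence of first parts, although only the
    largest one matters in the end. Both kinds of tableaux are encoded by the sets of boxes holding
    each letter, so one bijection serves both. *)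

Section RowSums.
Variables (R : comNzRingType) (z x y : R).

(** The arguments stand for mu_i, nu_i, mu_(i+1), nu_(i+1). The index [b] is row i+1 of the shape
    above mu and nu, whereas in [down_row_sum] the index [k] is row i of the shape below them; this
    shift lets the two be compared row by row. *)
Definition up_row_sum (m n m' n' : nat) : R :=
  \sum_(maxn m' n' <= b < m.+1)
    (x ^+ (b - m') * (1 - z * x) ^+ (b < m)%N
     * (y ^+ (minn b n - n') * z ^+ (b - n))).

Definition down_row_sum (m n m' n' : nat) : R :=
  \sum_(n' <= k < (minn m n).+1)
    (x ^+ (n - k) * (1 - z * x) ^+ (n' < k)%N
     * (y ^+ (m - maxn k m') * z ^+ (m' - k))).

Definition geom_core (k : nat) : R :=
  \sum_(i < k) (1 - z * x) * (x * y) ^+ i + (x * y) ^+ k.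

Lemma geom_telescope (u : R) k : \sum_(i < k) (1 - u) * u ^+ i + u ^+ k = 1.
Proof.
elim: k => [|k IH]; first by rewrite big_ord0 add0r expr0.
by rewrite big_ord_recr /= -[RHS]IH exprS; ring.
Qed.

Lemma sum_from (F : nat -> R) s m : (s <= m)%N ->
  \sum_(s <= b < m.+1) F b = \sum_(i < m - s) F (s + i)%N + F m.
Proof.
move=> sm; rewrite big_nat_recr //=; congr (_ + _).
by rewrite -{1}[s]add0n big_addn big_mkord; apply: eq_bigr => i _; rewrite addnC.
Qed.

(** Beyond [n] the monomials grow by the ratio [z * x], and the factor [1 - z * x], carried by every
    term except the last, makes the geometric sum telescope. *)
Lemma up_row_tail m n m' c s : (s <= m)%N -> (n <= s)%N -> (m' <= s)%N ->
  \sum_(s <= b < m.+1)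
    (x ^+ (b - m') * (1 - z * x) ^+ (b < m)%N * (c * z ^+ (b - n))) =
  x ^+ (s - m') * (c * z ^+ (s - n)).
Proof.
move=> sm ns ms; rewrite sum_from // ltnn expr0.
rewrite -[RHS]mulr1 -[X in _ = _ * X](geom_telescope (z * x) (m - s)).
rewrite mulrDr mulr_sumr.
congr (_ + _).
  apply: eq_bigr => -[i lti] _ /=.
  have -> : (s + i < m)%N by lia.
  have -> : (s + i - m' = (s - m') + i)%N by lia.
  have -> : (s + i - n = (s - n) + i)%N by lia.
  by rewrite expr1 !exprD exprMn; ring.
have -> : (m - m' = (s - m') + (m - s))%N by lia.
have -> : (m - n = (s - n) + (m - s))%N by lia.
by rewrite !exprD exprMn; ring.
Qed.

(** Terms with [b < n] form a geometric series in [x * y]; those beyond collapse by [up_row_tail].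
    If the intervals [m', m] and [n', n] are disjoint, either [n < m'] and only the collapsing part
    remains, or [m < n'] and the range is empty. *)
Lemma up_row_sumE m n m' n' : (m' <= m)%N -> (n' <= n)%N ->
  up_row_sum m n m' n' =
  if (maxn m' n' <= minn m n)%N then
    x ^+ (maxn m' n' - m') * y ^+ (maxn m' n' - n')
    * geom_core (minn m n - maxn m' n')
  else if (n < m')%N then y ^+ (n - n') * z ^+ (m' - n) else 0.
Proof.
move=> m'm n'n; rewrite /up_row_sum; set q := maxn m' n'.
case: ifP => [|qp].
  case: (leqP m n) => [mn|nm] qp.
    rewrite sum_from // /geom_core mulrDr mulr_sumr; congr (_ + _).
      apply: eq_bigr => -[i lti] _ /=.
      have -> : (q + i < m)%N by lia.
      have -> : (q + i - m' = (q - m') + i)%N by lia.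
      have -> : (minn (q + i) n - n' = (q - n') + i)%N by lia.
      have -> : (q + i - n = 0)%N by lia.
      by rewrite expr0 expr1 !exprD exprMn; ring.
    rewrite ltnn.
    have -> : (m - m' = (q - m') + (m - q))%N by lia.
    have -> : (minn m n - n' = (q - n') + (m - q))%N by lia.
    have -> : (m - n = 0)%N by lia.
    by rewrite !expr0 !exprD exprMn; ring.
  rewrite (@big_cat_nat _ _ _ n) /=; [|lia..].
  rewrite [X in _ + X](@eq_big_nat _ _ _ _ _ _ (fun b => x ^+ (b - m') *
    (1 - z * x) ^+ (b < m)%N * (y ^+ (n - n') * z ^+ (b - n)))); last first.
    by move=> b /andP[nb _]; rewrite (minn_idPr nb).
  rewrite up_row_tail //; [|lia..]; rewrite subnn expr0.
  rewrite -{1}[q]add0n big_addn big_mkord /geom_core mulrDr mulr_sumr.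
  congr (_ + _).
    apply: eq_bigr => -[i lti] _ /=.
    have -> : (i + q < m)%N by lia.
    have -> : (i + q - m' = (q - m') + i)%N by lia.
    have -> : (minn (i + q) n - n' = (q - n') + i)%N by lia.
    have -> : (i + q - n = 0)%N by lia.
    by rewrite expr0 expr1 !exprD exprMn; ring.
  have -> : (n - m' = (q - m') + (n - q))%N by lia.
  have -> : (n - n' = (q - n') + (n - q))%N by lia.
  by rewrite !exprD exprMn; ring.
case: ifP => [nm'|nm'].
  have -> : q = m' by rewrite /q; lia.
  rewrite (@eq_big_nat _ _ _ _ _ _ (fun b => x ^+ (b - m') *
    (1 - z * x) ^+ (b < m)%N * (y ^+ (n - n') * z ^+ (b - n)))); last first.
    by move=> b /andP[nb _]; congr (_ * (y ^+ _ * _)); lia.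
  by rewrite up_row_tail ?subnn ?expr0 ?mul1r //; lia.
by rewrite big_geq // /q; lia.
Qed.

(* Complementing all row lengths in a long row exchanges the two sums. *)
Lemma down_row_sum_rev m n m' n' C :
  (m' <= m)%N -> (n' <= n)%N -> (m <= C)%N -> (n <= C)%N ->
  down_row_sum m n m' n' = up_row_sum (C - n') (C - m') (C - n) (C - m).
Proof.
move=> m'm n'n mC nC; rewrite /down_row_sum /up_row_sum.
have -> : (maxn (C - n) (C - m) = C - minn m n)%N by lia.
case: (leqP n' (minn m n)) => [le|lt]; last by rewrite !big_geq //; lia.
rewrite big_nat_rev /= -{1}[n']add0n -[(C - minn m n)%N]add0n !big_addn.
have -> : ((C - n').+1 - (C - minn m n) = (minn m n).+1 - n')%N by lia.
apply: eq_big_nat => i /andP[_ lti].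
set k := (n' + _ - _)%N; have kE : (k = minn m n - i)%N by rewrite /k; lia.
have -> : (i + (C - minn m n) - (C - n) = n - k)%N by lia.
have -> : (i + (C - minn m n) < C - n')%N = (n' < k)%N by lia.
have -> : (minn (i + (C - minn m n)) (C - m') - (C - m) = m - maxn k m')%N by lia.
by have -> : (i + (C - minn m n) - (C - m') = m' - k)%N by lia.
Qed.

Lemma down_row_sumE m n m' n' : (m' <= m)%N -> (n' <= n)%N ->
  down_row_sum m n m' n' =
  if (maxn m' n' <= minn m n)%N then
    x ^+ (n - minn m n) * y ^+ (m - minn m n)
    * geom_core (minn m n - maxn m' n')
  else if (n < m')%N then y ^+ (m - m') * z ^+ (m' - n) else 0.
Proof.
move=> m'm n'n; rewrite (@down_row_sum_rev _ _ _ _ (m + n)); [|lia..].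
rewrite up_row_sumE; [|lia..].
have -> : (m + n - n = m)%N by lia.
have -> : (m + n - m = n)%N by lia.
have -> : (minn (m + n - n') (m + n - m') = m + n - maxn m' n')%N by lia.
have -> : (maxn m n <= m + n - maxn m' n')%N = (maxn m' n' <= minn m n)%N by lia.
have -> : (m + n - m' < m)%N = (n < m')%N by lia.
have -> : (maxn m n - m = n - minn m n)%N by lia.
have -> : (maxn m n - n = m - minn m n)%N by lia.
have -> : (m + n - maxn m' n' - maxn m n = minn m n - maxn m' n')%N by lia.
case: ifP => // nle; case: ifP => // lt.
have -> : (m + n - m' - n = m - m')%N by lia.
by have -> : (m - (m + n - m') = m' - n)%N by lia.
Qed.

(** The two closed forms share [geom_core] and differ by a monomial. The correcting monomials on
    both sides are one expression taken at rows i+1 and i, so they telescope in a product over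
    rows. *)
Lemma row_sums_balance m n m' n' : (m' <= m)%N -> (n' <= n)%N ->
  down_row_sum m n m' n'
    * (x ^+ (n' - minn m' n') * y ^+ (m' - minn m' n'))
  = up_row_sum m n m' n' * (x ^+ (n - minn m n) * y ^+ (m - minn m n)).
Proof.
move=> m'm n'n; rewrite down_row_sumE // up_row_sumE //.
case: ifP => [le|nle].
  have -> : (n' - minn m' n' = maxn m' n' - m')%N by lia.
  have -> : (m' - minn m' n' = maxn m' n' - n')%N by lia.
  by ring.
case: ifP => [lt|nlt]; last by rewrite !mul0r.
have -> : (n' - minn m' n' = 0)%N by lia.
have -> : (n - minn m n = 0)%N by lia.
have -> : (m - minn m n = m - n)%N by lia.
have -> : (m' - minn m' n' = m' - n')%N by lia.
rewrite !expr0 !mul1r mulrAC -exprD [RHS]mulrAC -exprD.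
by congr (y ^+ _ * _); lia.
Qed.

End RowSums.

(** * Partition vectors and the refined skew Cauchy identity *)

Section Vectors.
Variables L W : nat.

Definition vec : finType := {ffun 'I_L.+1 -> 'I_W.+1}.
Implicit Types mu nu la ka : vec.

Definition part_at mu (i : nat) : nat :=
  oapp (fun j : 'I_L.+1 => nat_of_ord (mu j)) 0%N (insub i).

(** A virtual row of length [W] above row 0 turns the interlacing condition on row 0 into the bound
    that every part satisfies anyway. *)
Definition part_above mu (i : nat) : nat :=
  if i is j.+1 then part_at mu j else W.

Lemma part_atE mu (i : 'I_L.+1) : part_at mu i = mu i.
Proof. by rewrite /part_at valK. Qed.

Lemma part_at_large mu i : (L < i)%N -> part_at mu i = 0%N.
Proof. by move=> Li; rewrite /part_at insubF // ltnNge Li. Qed.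

Lemma part_at_le mu i : (part_at mu i <= W)%N.
Proof.
by rewrite /part_at; case: insub => //= j; rewrite -ltnS ltn_ord.
Qed.

Lemma eq_part_at mu nu : (forall i, part_at mu i = part_at nu i) -> mu = nu.
Proof.
move=> e; apply/ffunP => i; apply: val_inj.
by have := e i; rewrite !part_atE.
Qed.

Definition is_partition mu : bool :=
  [forall i : 'I_L.+1, part_at mu i.+1 <= part_at mu i]%N.

Definition contains la mu : bool :=
  [forall i : 'I_L.+1, part_at mu i <= part_at la i]%N.

Definition hstrip mu la : bool :=
  [forall i : 'I_L.+1, part_at mu i <= part_at la i <= part_above mu i]%N.

Lemma forall_rowsP (P : nat -> bool) : (forall i, (L < i)%N -> P i) ->
  reflect (forall i, P i) [forall i : 'I_L.+1, P i].
Proof.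
move=> PL; apply: (iffP forallP) => [h i|h i //].
by case: (leqP i L) => [iL|/PL //]; apply: (h (Ordinal (iL : (i < L.+1)%N))).
Qed.

Lemma is_partitionP mu :
  reflect (forall i, part_at mu i.+1 <= part_at mu i)%N (is_partition mu).
Proof.
apply: (forall_rowsP (P := fun i => (part_at mu i.+1 <= part_at mu i)%N)).
by move=> i Li; rewrite part_at_large // ltnW.
Qed.

Lemma containsP la mu :
  reflect (forall i, part_at mu i <= part_at la i)%N (contains la mu).
Proof.
apply: (forall_rowsP (P := fun i => (part_at mu i <= part_at la i)%N)).
by move=> i Li; rewrite part_at_large.
Qed.

Lemma hstripP mu la :
  reflect (forall i, part_at mu i <= part_at la i <= part_above mu i)%N
          (hstrip mu la).
Proof.
apply: (forall_rowsP
  (P := fun i => (part_at mu i <= part_at la i <= part_above mu i)%N)).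
by move=> i Li; rewrite !part_at_large.
Qed.

Lemma hstrip_partition mu la : hstrip mu la -> is_partition la.
Proof.
move=> /hstripP h; apply/is_partitionP => i.
by have /andP[_ /=] := h i.+1; have /andP[+ _] := h i; lia.
Qed.

Lemma hstrip_partition_inner mu la : hstrip mu la -> is_partition mu.
Proof.
move=> /hstripP h; apply/is_partitionP => i.
by have /andP[] := h i.+1; rewrite /=; lia.
Qed.

Lemma sum_ord_between (V : nmodType) lo hi (F : nat -> V) : (hi <= W)%N ->
  \sum_(b < W.+1 | (lo <= b <= hi)%N) F b = \sum_(lo <= b < hi.+1) F b.
Proof.
move=> hiW; rewrite (big_nat_widen _ _ W.+1) ?ltnS // big_geq_mkord.
by apply: eq_bigl => b; rewrite ltnS andbC.
Qed.

Lemma sum_family (R : comNzRingType) (Q : nat -> pred nat)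
    (F : nat -> nat -> R) :
  \sum_(la : vec | [forall i : 'I_L.+1, Q i (part_at la i)])
     \prod_(i < L.+1) F i (part_at la i) =
  \prod_(i < L.+1) \sum_(b < W.+1 | Q i b) F i b.
Proof.
rewrite (bigA_distr_big_dep (fun (i : 'I_L.+1) (b : 'I_W.+1) => Q i b)
  (fun (i : 'I_L.+1) (b : 'I_W.+1) => F i b)).
apply: eq_big => la.
  by apply/forallP/familyP => h i; have := h i; rewrite unfold_in part_atE.
by move=> _; apply: eq_bigr => i _; rewrite part_atE.
Qed.

Section Weights.
Variables (R : comNzRingType) (z : R).

Definition up_weight (x : R) mu la : R := \prod_(i < L.+1)
  (x ^+ (part_at la i - part_at mu i)
   * (1 - z * x) ^+ (part_at la i.+1 < part_at mu i)%N).

Definition down_weight (y : R) la mu : R := \prod_(i < L.+1)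
  (y ^+ (part_at la i - maxn (part_at mu i) (part_at la i.+1))
   * z ^+ (part_at la i.+1 - part_at mu i)).

(* [down_weight] marks the lowest box of each column of the skew shape by [y];
   this form marks the highest one. *)
Lemma down_weight_top y la nu :
  is_partition la -> is_partition nu -> contains la nu ->
  down_weight y la nu = \prod_(i < L.+1)
    (y ^+ (minn (part_at la i) (part_above nu i) - part_at nu i)
     * z ^+ (part_at la i - part_above nu i)).
Proof.
move=> /is_partitionP pla /is_partitionP pnu /containsP nula.
rewrite /down_weight !big_split /= !prodrXr; congr (y ^+ _ * z ^+ _).
  pose S k := (\sum_(i < k) (part_at la i
                 - maxn (part_at nu i) (part_at la i.+1)))%N.
  pose T k := (\sum_(i < k) (minn (part_at la i) (part_above nu i)
                 - part_at nu i))%N.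
  (* The two counts of columns agree on the first [k.+1] rows up to a boundary term at row [k]; it
     vanishes for [k = L], where the next row of [la] is empty. *)
  have ST k : (S k.+1 + (maxn (part_at nu k) (part_at la k.+1) - part_at nu k)
               = T k.+1)%N.
    elim: k => [|k IH]; rewrite [S _]big_ord_recr [T _]big_ord_recr /=.
      rewrite !big_ord0 /=.
      by have := part_at_le la 0; have := pla 0%N; have := nula 0%N; lia.
    have := pla k.+1; have := pnu k; have := nula k.+1; have := nula k.
    by rewrite -/(S k.+1) -/(T k.+1); move: IH; move: (S _) (T _); lia.
  by have := ST L; rewrite (part_at_large la (ltnSn L)) maxn0 subnn addn0.
rewrite big_ord_recr /= (part_at_large la (ltnSn L)) sub0n addn0 big_ord_recl /=.
have -> : (part_at la 0 - W = 0)%N by have := part_at_le la 0; lia.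
by rewrite add0n; apply: eq_bigr.
Qed.

End Weights.

Lemma up_row_sum_last (R : comNzRingType) (z x y : R) n :
  up_row_sum z x y 0 n 0 0 = 1.
Proof.
rewrite up_row_sumE // maxnn min0n leqnn !subnn /geom_core.
by rewrite big_ord0 !expr0 add0r !mulr1.
Qed.

(** * The skew Cauchy identity with the first row left open *)

Section LocalIdentity.
Variables (R : idomainType) (z x y : R).
Hypotheses (x0 : x != 0) (y0 : y != 0).

Lemma sum_up_down (F : nat -> R) mu nu :
  is_partition mu -> is_partition nu -> part_at mu L = 0%N ->
  \sum_(la | hstrip mu la && contains la nu)
     F (part_at la 0) * (up_weight z x mu la * down_weight z y la nu) =
  (\sum_(maxn (part_at mu 0) (part_at nu 0) <= b < W.+1)
     F b * (x ^+ (b - part_at mu 0) * y ^+ (b - part_at nu 0)))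
  * \prod_(i < L) up_row_sum z x y (part_at mu i) (part_at nu i)
                            (part_at mu i.+1) (part_at nu i.+1).
Proof.
move=> pmu pnu muL.
pose Q i : pred nat := fun b =>
  (maxn (part_at mu i) (part_at nu i) <= b <= part_above mu i)%N.
pose H i b : R := (if i == 0%N then F b else 1) *
  (x ^+ (b - part_at mu i) * (1 - z * x) ^+ ((0 < i) && (b < part_above mu i))%N
  * (y ^+ (minn b (part_above nu i) - part_at nu i)
     * z ^+ (b - part_above nu i))).
transitivity (\prod_(i < L.+1) \sum_(b < W.+1 | Q i b) H i b).
  rewrite -sum_family; apply: eq_big => [la|la /andP[hs ct]].
    apply/andP/forallP => [[/hstripP hs /containsP ct] i|h].
      by rewrite /Q; have := hs i; have := ct i; lia.
    split; apply/forallP => i; have := h i; rewrite /Q; lia.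
  (* The original down weight couples consecutive rows of [la]; the top form involves one row of
     [la] at a time, as the factorisation requires. *)
  rewrite down_weight_top ?(hstrip_partition hs) // !big_split /= mulrA.
  rewrite !mulrA; do 2 congr (_ * _).
  rewrite big_ord_recl /= big1 ?mulr1; last by move=> i _.
  rewrite /up_weight big_split /= -mulrA; congr (_ * (_ * _)).
  (* The factors [1 - z * x] are shifted from row i to row i+1. The one at row [L] has nowhere to go
     and is trivial because [mu] is empty there. *)
  rewrite big_ord_recr /= muL ltn0 expr0 mulr1.
  by rewrite [RHS]big_ord_recl /= expr0 mul1r.
rewrite big_ord_recl /=; congr (_ * _).
  rewrite /Q /= sum_ord_between //.
  apply: eq_big_nat => b /andP[_ bW]; rewrite /H /= expr0 mulr1.
  by rewrite (minn_idPl _) // (_ : (b - W = 0)%N) ?expr0 ?mulr1 //; lia.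
apply: eq_bigr => i _; rewrite /bump add1n /Q /= sum_ord_between ?part_at_le //.
by apply: eq_big_nat => b _; rewrite /H /= mul1r.
Qed.

Lemma sum_down_up mu nu : is_partition mu -> is_partition nu ->
  \sum_(ka | hstrip ka nu && contains mu ka)
     up_weight z x ka nu * down_weight z y mu ka =
  \prod_(i < L.+1) down_row_sum z x y (part_at mu i) (part_at nu i)
                            (part_at mu i.+1) (part_at nu i.+1).
Proof.
move=> pmu pnu.
pose Q i : pred nat := fun k =>
  (part_at nu i.+1 <= k <= minn (part_at mu i) (part_at nu i))%N.
pose H i k : R :=
  x ^+ (part_at nu i - k) * (1 - z * x) ^+ (part_at nu i.+1 < k)%N
  * (y ^+ (part_at mu i - maxn k (part_at mu i.+1))
     * z ^+ (part_at mu i.+1 - k)).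
transitivity (\prod_(i < L.+1) \sum_(b < W.+1 | Q i b) H i b).
  rewrite -sum_family; apply: eq_big => [ka|ka _].
    apply/andP/forallP => [[/hstripP hs /containsP ct] i|].
      by rewrite /Q; have := hs i; have := hs i.+1; have := ct i; rewrite /=; lia.
    move=> h0; have h i : Q i (part_at ka i).
      case: (leqP i L) => [iL|Li]; first exact: (h0 (Ordinal (iL : i < L.+1)%N)).
      by rewrite /Q !part_at_large // ltnW.
    split; apply/forallP => i; have := h i; rewrite /Q; last by lia.
    case: (nat_of_ord i) => [|j] /=; first by have := part_at_le nu 0; lia.
    by have := h j; rewrite /Q; lia.
  by rewrite -big_split.
apply: eq_bigr => i _; rewrite /Q sum_ord_between //.
by have := part_at_le mu i; lia.
Qed.

(** Multiplying [row_sums_balance] over all rows and cancelling the nonzero monomials [d i.+1]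
    leaves only [d 0]. It turns [x ^+ (b - mu_0) * y ^+ (b - nu_0)] into a power of [x * y] counted
    from the larger of the two first parts. *)
Lemma skew_cauchy_first_part (F : nat -> R) mu nu :
  is_partition mu -> is_partition nu -> part_at mu L = 0%N ->
  \sum_(la | hstrip mu la && contains la nu)
     F (part_at la 0) * (up_weight z x mu la * down_weight z y la nu) =
  (\sum_(maxn (part_at mu 0) (part_at nu 0) <= b < W.+1)
     F b * (x * y) ^+ (b - maxn (part_at mu 0) (part_at nu 0)))
  * \sum_(ka | hstrip ka nu && contains mu ka)
      up_weight z x ka nu * down_weight z y mu ka.
Proof.
move=> pmu pnu muL; rewrite sum_up_down // sum_down_up //.
pose d i := x ^+ (part_at nu i - minn (part_at mu i) (part_at nu i))
          * y ^+ (part_at mu i - minn (part_at mu i) (part_at nu i)).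
pose up i := up_row_sum z x y (part_at mu i) (part_at nu i)
                            (part_at mu i.+1) (part_at nu i.+1).
pose down i := down_row_sum z x y (part_at mu i) (part_at nu i)
                            (part_at mu i.+1) (part_at nu i.+1).
have d0 : \prod_(i < L) d i.+1 != 0.
  by apply/prodf_neq0 => i _; rewrite mulf_neq0 // expf_neq0.
have balance : \prod_(i < L.+1) down i = d 0%N * \prod_(i < L) up i.
  apply: (mulIf d0).
  transitivity (\prod_(i < L.+1) (down i * d i.+1)).
    rewrite [RHS]big_split /=; congr (_ * _).
    by rewrite big_ord_recr /= /d !part_at_large // !expr0 !mulr1.
  transitivity (\prod_(i < L.+1) (up i * d i)).
    apply: eq_bigr => i _; apply: row_sums_balance.
      exact: (is_partitionP _ pmu).
    exact: (is_partitionP _ pnu).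
  rewrite [LHS]big_split /= big_ord_recr /= [up L]/up muL.
  rewrite !(part_at_large _ (ltnSn L)) up_row_sum_last.
  by rewrite mulr1 [X in _ * X = _]big_ord_recl /= mulrCA mulrA.
rewrite -/(down _) balance mulrA; congr (_ * _).
rewrite mulr_suml; apply: eq_big_nat => b /andP[Mb _]; rewrite /d -mulrA.
congr (_ * _); rewrite exprMn mulrACA -!exprD.
by congr (x ^+ _ * y ^+ _); lia.
Qed.

End LocalIdentity.
End Vectors.

(** * Chains of partitions *)

Section Chains.
Variables L W : nat.
Local Notation vec := (vec L W).
Implicit Types mu nu la ka : vec.

Definition vec0 : vec := [ffun=> ord0].

Lemma part_at_vec0 i : part_at vec0 i = 0%N.
Proof. by rewrite /part_at; case: insub => //= j; rewrite ffunE. Qed.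

Lemma vec0P mu : reflect (forall i, part_at mu i = 0%N) (mu == vec0).
Proof.
apply: (iffP eqP) => [-> i|h]; first exact: part_at_vec0.
by apply: eq_part_at => i; rewrite h part_at_vec0.
Qed.

Lemma is_partition_vec0 : is_partition vec0.
Proof. by apply/is_partitionP => i; rewrite !part_at_vec0. Qed.

Lemma contains_vec0 ka : contains vec0 ka = (ka == vec0).
Proof.
apply/containsP/vec0P => h i; first by have := h i; rewrite part_at_vec0; lia.
by rewrite h part_at_vec0.
Qed.

Lemma up_weight_vec0 (R : comNzRingType) (z x : R) :
  up_weight z x vec0 vec0 = 1.
Proof.
by rewrite /up_weight big1 // => i _; rewrite !part_at_vec0 subnn !expr0 mulr1.
Qed.

Lemma down_weight_vec0 (R : comNzRingType) (z y : R) :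
  down_weight z y vec0 vec0 = 1.
Proof.
by rewrite /down_weight big1 // => i _; rewrite !part_at_vec0 subnn !expr0 mulr1.
Qed.

Section Def.
Variables (R : comNzRingType) (z : R).

Fixpoint up_chain (xs : seq R) la : R :=
  if xs is x :: xs' then
    \sum_(mu | hstrip mu la) up_weight z x mu la * up_chain xs' mu
  else (la == vec0)%:R.

(* [F] is applied to the sequence of first parts along the chain. *)
Fixpoint down_chain (ys : seq R) la (F : seq nat -> R) : R :=
  if ys is y :: ys' then
    \sum_(ka | is_partition ka && contains la ka)
      down_weight z y la ka * down_chain ys' ka (fun l => F (part_at la 0 :: l))
  else (la == vec0)%:R * F [:: 0%N].

Lemma eq_down_chain ys la (F G : seq nat -> R) :
  (forall l, F (part_at la 0 :: l) = G (part_at la 0 :: l)) ->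
  down_chain ys la F = down_chain ys la G.
Proof.
elim: ys la F G => [|y ys IH] la F G FG /=.
  have [/vec0P la0|_] := boolP (la == vec0); last by rewrite !mul0r.
  by have := FG [::]; rewrite la0 => ->.
by apply: eq_bigr => ka _; congr (_ * _); apply: IH => l; apply: FG.
Qed.

Lemma down_chain_sum ys la I (r : seq I) (F : I -> seq nat -> R) (c : I -> R) :
  down_chain ys la (fun l => \sum_(i <- r) F i l * c i) =
  \sum_(i <- r) down_chain ys la (F i) * c i.
Proof.
elim: ys la F => [|y ys IH] la F /=.
  by rewrite mulr_sumr; apply: eq_bigr => i _; rewrite mulrA.
rewrite -(eq_bigr _ (fun i _ => esym (mulr_suml _ _ _ _))) exchange_big /=.
apply: eq_bigr => ka _; rewrite IH mulr_sumr.
by apply: eq_bigr => i _; rewrite mulrA.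
Qed.

Lemma down_chain0 ys F : down_chain ys vec0 F = F (nseq (size ys).+1 0%N).
Proof.
elim: ys F => [|y ys IH] F /=; first by rewrite eqxx mul1r.
rewrite (big_pred1 vec0) => [|ka]; last first.
  rewrite /= contains_vec0; case: eqP => [->|_]; last by rewrite andbF.
  by rewrite is_partition_vec0.
by rewrite down_weight_vec0 mul1r IH part_at_vec0.
Qed.

(** A horizontal strip adds at most one nonempty row, so [size xs] steps from the empty shape reach
    at most that many rows. *)
Lemma up_chain_eq0 xs mu i : (size xs <= i)%N -> part_at mu i != 0%N ->
  up_chain xs mu = 0.
Proof.
elim: xs mu i => [|x xs IH] mu i /=.
  by move=> _; case: vec0P => // -> //.
case: i => // i le nz; rewrite big1 // => ka /hstripP h.
rewrite (IH ka i) ?mulr0 //.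
by have := h i.+1; rewrite /=; lia.
Qed.

(* Commuting one up step through [ys] replaces the functional [F] by this one,
   which does not involve [z]. *)
Fixpoint transfer (x : R) (ys : seq R) (F : seq nat -> R) : seq nat -> R :=
  if ys is y :: ys' then fun l => transfer x ys' (fun l' =>
    \sum_(maxn (head 0%N l) (head 0%N l') <= b < W.+1)
      F (b :: l') * (x * y) ^+ (b - maxn (head 0%N l) (head 0%N l')))
    (behead l)
  else F.

End Def.

(** * Independence of the parameter *)

Section Independence.
Variables (R : idomainType).

Lemma sum_up_down_chain (z x : R) ys mu F : x != 0 -> 0 \notin ys ->
  is_partition mu -> part_at mu L = 0%N ->
  \sum_(la | hstrip mu la) up_weight z x mu la * down_chain z ys la F =
  down_chain z ys mu (transfer x ys F).
Proof.
move=> x0; elim: ys mu F => [|y ys IH] mu F.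
  move=> _ pmu muL /=; have [->|mu0] := eqVneq mu vec0.
    rewrite (bigD1 vec0) /=; last first.
      by apply/hstripP => i; rewrite !part_at_vec0.
    rewrite up_weight_vec0 eqxx big1 ?addr0 ?mul1r // => la /andP[_ /negPf->].
    by rewrite mul0r mulr0.
  rewrite mul0r big1 // => la /hstripP h.
  case: eqP => [la0|_]; last by rewrite mul0r mulr0.
  case/vec0P: mu0 => i; have := h i; rewrite la0 part_at_vec0; lia.
rewrite inE negb_or eq_sym => /andP[y0 ys0] pmu muL /=.
set F1 := fun l' => \sum_(_ <= b < _) _.
under eq_bigr => la _ do rewrite mulr_sumr.
rewrite (exchange_big_dep (@is_partition L W)) /=; last by move=> la nu _ /andP[].
transitivity (\sum_(nu | is_partition nu)
   (\sum_(ka | hstrip ka nu && contains mu ka)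
      up_weight z x ka nu * down_weight z y mu ka) * down_chain z ys nu F1).
  apply: eq_bigr => nu pnu.
  (* For fixed [nu], the remainder of the chain sees [la] only through its first part, so it can
     serve as the arbitrary weight of the first row. *)
  pose Phi b := down_chain z ys nu (fun l => F (b :: l)).
  transitivity (\sum_(la | hstrip mu la && contains la nu)
     Phi (part_at la 0) * (up_weight z x mu la * down_weight z y la nu)).
    apply: eq_big => [la|la _]; first by rewrite pnu.
    by rewrite /Phi mulrA mulrC.
  rewrite skew_cauchy_first_part // mulrC; congr (_ * _).
  rewrite -down_chain_sum; apply: eq_down_chain => l.
  by rewrite /F1 /=.
under [LHS]eq_bigr => nu _ do rewrite mulr_suml.
rewrite (exchange_big_dep (fun ka => is_partition ka && contains mu ka)) /=;
  last by move=> nu ka _ /andP[/hstrip_partition_inner -> ->].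
apply: eq_bigr => ka /andP[pka muka].
rewrite -[RHS]/(_ * down_chain z ys ka (transfer x ys F1)) -IH //; last first.
  by have /containsP/(_ L) := muka; rewrite muL; lia.
rewrite mulr_sumr; apply: eq_big => [nu|nu _].
  rewrite muka andbT; case: (boolP (hstrip _ _)) => [h|]; last by rewrite andbF.
  by rewrite (hstrip_partition h).
by rewrite -mulrA mulrCA.
Qed.

(** Removing one up step replaces [F] by [transfer x ys F], the same for every parameter. With no up
    step left only the empty shape survives, and both sides are [F] at a sequence of zeros. *)
Lemma up_down_chain_indep (z z' : R) xs ys F : (size xs <= L)%N ->
  0 \notin xs -> 0 \notin ys ->
  \sum_(la | is_partition la) up_chain z xs la * down_chain z ys la F =
  \sum_(la | is_partition la) up_chain z' xs la * down_chain z' ys la F.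
Proof.
elim: xs F => [|x xs IH] F.
  move=> _ _ _; rewrite !(bigD1 vec0 is_partition_vec0) /= !eqxx !down_chain0.
  by rewrite !big1 // => la /andP[_ /negPf->]; rewrite mul0r.
rewrite inE negb_or eq_sym => szL /andP[x0 xs0] ys0.
suff step w : \sum_(la | is_partition la)
    up_chain w (x :: xs) la * down_chain w ys la F =
  \sum_(la | is_partition la)
    up_chain w xs la * down_chain w ys la (transfer x ys F).
  by rewrite !step; apply: IH => //; apply: ltnW.
rewrite /=; under [LHS]eq_bigr => la _ do rewrite mulr_suml.
rewrite (exchange_big_dep (@is_partition L W)) /=; last first.
  by move=> la mu _ /hstrip_partition_inner.
apply: eq_bigr => mu pmu; have [muL|muL] := eqVneq (part_at mu L) 0%N.
  rewrite -sum_up_down_chain // mulr_sumr; apply: eq_big => [la|la _].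
    by case: (boolP (hstrip _ _)) => [/hstrip_partition->|]; rewrite ?andbF.
  by rewrite [_ * up_chain _ _ _]mulrC mulrA.
rewrite (up_chain_eq0 _ (ltnW szL)) // mul0r big1 // => la _.
by rewrite mulr0 mul0r.
Qed.

End Independence.
End Chains.

(** * Level sets of tableaux *)

Lemma sum_tuple_cons (V : nmodType) (T : finType) n (P : pred (seq T))
    (F : seq T -> V) :
  \sum_(t : n.+1.-tuple T | P t) F t =
  \sum_(x : T) \sum_(t : n.-tuple T | P (x :: t)) F (x :: t).
Proof.
rewrite pair_big_dep /=.
rewrite (reindex (fun p : T * n.-tuple T => [tuple of p.1 :: p.2])) //=.
exists (fun t => (thead t, [tuple of behead t])) => [[x t]|t] _.
  by congr pair; rewrite ?theadE //; apply: val_inj.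
by apply: val_inj; rewrite [in RHS](tuple_eta t).
Qed.

Lemma sum_tuple0 (V : nmodType) (T : finType) (P : pred (seq T))
    (F : seq T -> V) :
  \sum_(t : 0.-tuple T | P t) F t = if P [::] then F [::] else 0.
Proof.
rewrite big_mkcond (big_pred1 [tuple]) //= => t.
by apply/esym/eqP; apply: tuple0.
Qed.

Section LevelSets.
Variables L W : nat.
Local Notation vec := (vec L W).
Local Notation vec0 := (@vec0 L W).
Implicit Types mu nu la ka : vec.

Definition grid : finType := ('I_L.+1 * 'I_W)%type.
Implicit Types (U A : {set grid}) (s : seq {set grid}) (b c : grid).

Definition boxes la : {set grid} := [set b : grid | b.2 < part_at la b.1]%N.

Lemma grid_box la i j : (j < part_at la i)%N ->
  exists b : grid, [/\ b \in boxes la, b.1 = i :> nat & b.2 = j :> nat].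
Proof.
move=> jla; have iL : (i < L.+1)%N.
  by rewrite ltnNge; apply/negP => Li; rewrite part_at_large in jla.
have jW : (j < W)%N by apply: leq_trans jla (part_at_le _ _).
by exists (Ordinal iL, Ordinal jW); rewrite inE.
Qed.

Lemma eq_grid (b c : grid) : b.1 = c.1 :> nat -> b.2 = c.2 :> nat -> b = c.
Proof. by case: b c => [i j] [i' j'] /= /val_inj-> /val_inj->. Qed.

Lemma boxes_inj : injective boxes.
Proof.
suff le mu nu : boxes mu = boxes nu -> forall i, (part_at mu i <= part_at nu i)%N.
  move=> mu nu e; apply: eq_part_at => i.
  by apply/eqP; rewrite eqn_leq !le.
move=> e i; rewrite leqNgt; apply/negP => /grid_box[b [+ bi bj]].
by rewrite e inE bi bj ltnn.
Qed.

Lemma boxes0 la : (boxes la == set0) = (la == vec0).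
Proof.
have -> : set0 = boxes vec0 by apply/setP => b; rewrite !inE part_at_vec0.
by apply/eqP/eqP => [/boxes_inj|->].
Qed.

Lemma row_closed_boxes (A : {set grid}) :
  (forall b c : grid, b \in A -> c.1 = b.1 -> (c.2 < b.2)%N -> c \in A) ->
  exists mu, A = boxes mu.
Proof.
move=> Acl; pose m (i : 'I_L.+1) := (\max_(j < W | (i, j) \in A) j.+1)%N.
have mW i : (m i < W.+1)%N by rewrite ltnS; apply/bigmax_leqP => j _.
exists [ffun i => Ordinal (mW i)]; apply/setP => -[i j].
rewrite inE /= part_atE ffunE /=; apply/idP/idP => [Aij|jm].
  exact: (@leq_bigmax_cond _ (fun j => (i, j) \in A) (fun j => j.+1) j Aij).
have : (0 < #|[pred j | (i, j) \in A]|)%N.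
  rewrite lt0n; apply/negP => /eqP/card0_eq A0.
  move: jm; rewrite /m big_pred0 // => k; exact: A0.
case/(eq_bigmax_cond (fun j : 'I_W => j.+1)) => k; rewrite inE => Aik mk.
have : (j < k.+1)%N by rewrite -mk.
rewrite ltnS leq_eqVlt => /predU1P[/val_inj->//|jk].
exact: (Acl (i, k)).
Qed.

Section Relations.
(* [r b c] must hold whenever [b] carries a larger entry than [c], and [q b c]
   whenever both carry the same entry. *)
Variables r q : rel grid.

Definition extends (U A : {set grid}) : bool :=
  [forall b in U, forall c in A, r b c] && [forall b in U, forall c in U, q b c].

Lemma extendsP U A : reflect
  ((forall b c, b \in U -> c \in A -> r b c)
   /\ (forall b c, b \in U -> c \in U -> q b c)) (extends U A).
Proof.
apply: (iffP andP) => [[/forall_inP h1 /forall_inP h2]|[h1 h2]]; split.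
- by move=> b c bS cA; apply: (forall_inP (h1 b bS)).
- by move=> b c bS cA; apply: (forall_inP (h2 b bS)).
- by apply/forall_inP => b bS; apply/forall_inP => c cA; apply: h1.
- by apply/forall_inP => b bS; apply/forall_inP => c cA; apply: h2.
Qed.

Definition cup (s : seq {set grid}) : {set grid} := \bigcup_(A <- s) A.

Lemma cup_cons U s : cup (U :: s) = U :|: cup s.
Proof. by rewrite /cup big_cons. Qed.

Lemma cupP s b : reflect (exists i, b \in nth set0 s i) (b \in cup s).
Proof.
elim: s => [|A s IH].
  by rewrite /cup big_nil inE; constructor; case=> i; rewrite nth_nil inE.
rewrite cup_cons inE; apply: (iffP orP) => [[bA|/IH[i bi]]|[[|i] bi]].
- by exists 0%N.
- by exists i.+1.
- by left.
- by right; apply/IH; exists i.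
Qed.

Fixpoint admissible (s : seq {set grid}) : bool :=
  if s is U :: s' then extends U (cup s') && admissible s' else true.

Lemma admissibleP s : reflect
  ((forall i j b c, (i < j)%N -> b \in nth set0 s i -> c \in nth set0 s j -> r b c)
   /\ (forall i b c, b \in nth set0 s i -> c \in nth set0 s i -> q b c))
  (admissible s).
Proof.
elim: s => [|U s IH] /=.
  by constructor; split=> [i j|i] b c; rewrite !nth_nil inE.
apply: (iffP andP) => [[/extendsP[h1 h2] /IH[h3 h4]]|[h1 h2]]; split.
- move=> [|i] [|j] b c //= ij bi cj; last exact: (h3 i j).
  by apply: h1 => //; apply/cupP; exists j.
- by move=> [|i]; [exact: h2|exact: h4].
- apply/extendsP; split => [b c bS /cupP[j cj]|b c bS cS].
    exact: (h1 0%N j.+1).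
  exact: (h2 0%N).
- apply/IH; split => [i j b c ij|i]; last exact: (h2 i.+1).
  exact: (h1 i.+1 j.+1).
Qed.

Section Sums.
Variable R : comNzRingType.
Variable e : {set grid} -> nat.
Variable f : {set grid} -> {set grid} -> R.

Fixpoint coeff (s : seq {set grid}) : R :=
  if s is U :: s' then f U (cup s') * coeff s' else 1.

Fixpoint mon (xs : seq R) (s : seq {set grid}) : R :=
  if (xs, s) is (x :: xs', U :: s') then x ^+ e U * mon xs' s' else 1.

Definition level_sum (xs : seq R) la : R :=
  \sum_(t : (size xs).-tuple {set grid} | admissible t && (cup t == boxes la))
     coeff t * mon xs t.

Definition step_sum (x : R) mu la : R :=
  \sum_(U | extends U (boxes mu) && (U :|: boxes mu == boxes la))
     f U (boxes mu) * x ^+ e U.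

Lemma level_sum_nil la : level_sum [::] la = (la == vec0)%:R.
Proof.
rewrite /level_sum /= (sum_tuple0 (fun s => admissible s && (cup s == boxes la))
  (fun s => coeff s * mon [::] s)) /= mulr1.
rewrite /cup big_nil eq_sym boxes0; by case: eqP.
Qed.

(** The last hypothesis makes the boxes of the smaller letters a partition shape, unique by
    [boxes_inj]; each tuple is thus counted for exactly one [mu]. *)
Lemma level_sum_cons x xs la : is_partition la ->
  (forall U A, extends U A -> U :|: A = boxes la ->
     exists2 mu, is_partition mu & A = boxes mu) ->
  level_sum (x :: xs) la =
  \sum_(mu | is_partition mu) step_sum x mu la * level_sum xs mu.
Proof.
move=> pla ext; rewrite /level_sum /=.
rewrite (sum_tuple_cons _ (fun s => admissible s && (cup s == boxes la))
  (fun s => coeff s * mon (x :: xs) s)) /=.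
pose G mu U (t : (size xs).-tuple {set grid}) : R :=
  if extends U (boxes mu) && (U :|: boxes mu == boxes la)
     && (admissible t && (cup t == boxes mu))
  then (f U (boxes mu) * x ^+ e U) * (coeff t * mon xs t) else 0.
transitivity (\sum_(mu | is_partition mu) \sum_U \sum_t G mu U t); last first.
  apply: eq_bigr => mu _; rewrite mulr_suml [RHS]big_mkcond /=.
  apply: eq_bigr => U _; rewrite /G; case: ifP => _; last by rewrite big1.
  by rewrite mulr_sumr [RHS]big_mkcond; apply: eq_bigr => t _; case: ifP.
rewrite exchange_big /=; apply: eq_bigr => U _.
rewrite exchange_big /= big_mkcond; apply: eq_bigr => t _.
case: ifP => [/andP[/andP[St at_] /eqP Sla]|nok]; last first.
  rewrite big1 // => mu pmu; rewrite /G; case: ifP => // /andP[/andP[h1 /eqP h2]].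
  case/andP=> h3 /eqP h4; move: nok.
  by rewrite cup_cons h4 h1 h3 h2 eqxx.
rewrite cup_cons in Sla; have [mu pmu tmu] := ext _ _ St Sla.
rewrite (bigD1 mu) //= big1 => [|nu /andP[pnu numu]]; last first.
  rewrite /G; case: ifP => // /andP[_ /andP[_ /eqP]].
  by rewrite tmu => /boxes_inj e'; rewrite e' eqxx in numu.
by rewrite /G -tmu St Sla !eqxx at_ addr0; ring.
Qed.

End Sums.
End Relations.

(** Only boxes sharing a row or a column are constrained: there [c] must lie weakly above or to the
    left of [b]. Taking [b = c] is allowed, so one box may hold several letters. *)
Definition above_left (b c : grid) : bool :=
  ((b.2 == c.2) ==> (c.1 <= b.1)%N) && ((b.1 == c.1) ==> (c.2 <= b.2)%N).

(** A box of [la] above or to the left of a box of [A] in the same line cannot lie in [U], since it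
    would carry a larger letter than the box of [A]. So it lies in [A], which is therefore closed
    upwards and leftwards. *)
Lemma extends_partition (r q : rel grid) la U A :
  (forall b c, r b c -> above_left b c) -> is_partition la ->
  extends r q U A -> U :|: A = boxes la ->
  exists2 mu, is_partition mu & A = boxes mu.
Proof.
move=> rab /is_partitionP pla /extendsP[rSA _] SA.
have Ala b : b \in A -> (b.2 < part_at la b.1)%N.
  by move=> bA; suff : b \in boxes la; [rewrite inE|rewrite -SA inE bA orbT].
have cl b c : b \in A -> c \in boxes la -> ~~ above_left c b -> c \in A.
  move=> bA; rewrite -SA inE => /orP[cS|//].
  by rewrite (rab _ _ (rSA _ _ cS bA)).
have [|mu Amu] := row_closed_boxes (A := A).
  move=> b c bA cb1 cb2; apply: (cl b) => //.
    by rewrite inE cb1; apply: ltn_trans cb2 (Ala _ bA).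
  by rewrite /above_left cb1 eqxx negb_and /= -!ltnNge cb2 orbT.
exists mu => //; apply/is_partitionP => i; rewrite leqNgt; apply/negP.
move=> /grid_box[b [+ b1 b2]]; rewrite -Amu => bA.
have ila : (part_at mu i < part_at la i)%N.
  by apply: leq_trans (pla i); have := Ala b bA; rewrite b1 b2.
have [c [cla c1 c2]] := grid_box ila.
suff : c \in A by rewrite Amu inE c1 c2 ltnn.
apply: (cl b) => //; rewrite /above_left.
have -> : c.2 == b.2 by rewrite -val_eqE /= b2 c2.
by rewrite negb_and /= b1 c1 -ltnNge ltnSn.
Qed.

Section RowProducts.
Variable R : comNzRingType.

Lemma prod_between (x : R) m l : (l <= W)%N ->
  \prod_(j < W) (if (m <= j < l)%N then x else 1) = x ^+ (l - m).
Proof.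
move=> lW; rewrite -big_mkcond -prodr_const_nat (big_nat_widen _ _ W) //.
by rewrite big_geq_mkord; apply: eq_bigl => j; rewrite andbC.
Qed.

Lemma prod_last (u : R) m l' : (m <= W)%N ->
  \prod_(j < W) (if (j.+1 == m) && (l' <= j)%N then u else 1) = u ^+ (l' < m)%N.
Proof.
move=> mW; rewrite -big_mkcond; case: (ltnP l' m) => lm.
  have mW' : (m.-1 < W)%N by lia.
  rewrite (big_pred1 (Ordinal mW')) // => j /=; rewrite -val_eqE /=.
  by apply/andP/eqP => [[/eqP]|]; [lia|move=> ->; split; [apply/eqP|]; lia].
rewrite big1 // => j /andP[/eqP]; lia.
Qed.

End RowProducts.

Lemma card_between (m l : nat -> nat) : (forall i, l i <= W)%N ->
  #|[set b : grid | m b.1 <= b.2 < l b.1]%N| = (\sum_(i < L.+1) (l i - m i))%N.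
Proof.
move=> lW; rewrite -sum1_card (eq_bigl (fun b : grid => m b.1 <= b.2 < l b.1)%N).
  rewrite -(pair_big_dep predT (fun (i : 'I_L.+1) (j : 'I_W) => (m i <= j < l i)%N)
    (fun _ _ => 1%N)) /=; apply: eq_bigr => i _.
  transitivity (\sum_(m i <= j < l i) 1)%N; last by rewrite sum_nat_const_nat muln1.
  rewrite (big_nat_widen _ _ W) // big_geq_mkord.
  by apply: eq_bigl => j; rewrite andbC.
by move=> b; rewrite inE.
Qed.

End LevelSets.

(** * Adding the largest letter, for both families *)

Section Steps.
Variables L W : nat.
Local Notation vec := (vec L W).
Local Notation vec0 := (@vec0 L W).
Local Notation grid := (grid L W).
Implicit Types (mu la : vec) (U A : {set grid}) (b c : grid).

(** As [extends] imposes this on both orders of each pair, it says that a letter occurs at most once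
    in a column. *)
Definition same_letter_svt b c : bool := (b.2 == c.2) ==> (c.1 <= b.1)%N.

Definition new_box mu la b : bool :=
  (part_at mu b.1 <= b.2 < part_at la b.1)%N.

Definition free_corner mu la b : bool :=
  (b.2.+1 == part_at mu b.1) && (part_at la b.1.+1 <= b.2)%N.

Lemma part_at_le_trans la i j : is_partition la -> (i <= j)%N ->
  (part_at la j <= part_at la i)%N.
Proof.
move=> /is_partitionP pla; elim: j => [|j IH]; first by rewrite leqn0 => /eqP->.
rewrite leq_eqVlt => /predU1P[->//|ij].
exact: leq_trans (pla j) (IH ij).
Qed.

(** The largest letter must fill every new box. It may also join an occupied box, provided that box
    ends its row of [mu] and has no box of [la] below it; these corners are chosen freely and
    independently. *)
Lemma extends_svt mu la U : is_partition mu -> is_partition la ->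
  extends (@above_left L W) same_letter_svt U (boxes mu)
    && (U :|: boxes mu == boxes la)
  = hstrip mu la && [forall b, (new_box mu la b ==> (b \in U)) &&
      ((b \in U) ==> new_box mu la b || free_corner mu la b)].
Proof.
move=> pmu pla; have [pm pl] := (is_partitionP _ pmu, is_partitionP _ pla).
apply/andP/andP => [[/extendsP[rU qU] /eqP Ula]|[/hstripP hs /forallP bU]].
  have inla b : (b \in U) || (b.2 < part_at mu b.1)%N = (b.2 < part_at la b.1)%N.
    by have := congr1 (fun B : {set grid} => b \in B) Ula; rewrite !inE.
  have col_ge b c : b \in U -> (b.2 = c.2 :> nat) -> (b.1 < c.1)%N ->
      (c.2 < part_at la c.1)%N -> False.
    move=> bU bc2 bc1; rewrite -inla => /orP[cU|cmu].
      have := qU b c bU cU.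
      by rewrite /same_letter_svt -val_eqE /= bc2 eqxx /= leqNgt bc1.
    have /andP[+ _] : above_left b c by apply: rU => //; rewrite inE.
    by rewrite -val_eqE /= bc2 eqxx /= leqNgt bc1.
  have mula i : (part_at mu i <= part_at la i)%N.
    rewrite leqNgt; apply/negP => /grid_box[b [bmu b1 b2]].
    by have := inla b; rewrite inE in bmu; rewrite bmu orbT b1 b2 ltnn.
  split; [apply/hstripP => i; rewrite mula /=|apply/forallP => b].
    case: i => [|i] /=; first exact: part_at_le.
    rewrite leqNgt; apply/negP => /grid_box[c [+ c1 c2]]; rewrite inE => cla.
    have /grid_box[b [+ b1 b2]] : (part_at mu i < part_at la i)%N.
      by rewrite -c2; apply: leq_trans cla _; rewrite c1.
    rewrite inE -inla b1 b2 ltnn orbF => bU.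
    by apply: (col_ge b c) => //; rewrite ?b2 ?c2 // b1 c1.
  apply/andP; split; apply/implyP; first move=> /andP[mub].
    by rewrite -inla ltnNge mub orbF.
  move=> bU; have := inla b; rewrite bU /= => /esym bla; rewrite /new_box bla andbT.
  case: leqP => //= bmu; apply/andP; split.
    rewrite eqn_leq bmu leqNgt; apply/negP => /grid_box[c [cmu c1 c2]].
    have /andP[_] := rU b c bU cmu.
    by rewrite -val_eqE /= c1 eqxx /= c2 ltnn.
  rewrite leqNgt; apply/negP => b1la.
  have [c [+ c1 c2]] := grid_box b1la; rewrite inE => cla.
  by apply: (col_ge b c) => //; rewrite c1.
have bU1 b : new_box mu la b -> b \in U by have /andP[/implyP] := bU b.
have bU2 b : b \in U -> new_box mu la b || free_corner mu la b.
  by have /andP[_ /implyP] := bU b.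
have mula i : (part_at mu i <= part_at la i)%N by have /andP[] := hs i.
have Ula b : b \in U -> (b.2 < part_at la b.1)%N.
  move=> /bU2/orP[/andP[]//|/andP[/eqP b2 _]].
  by rewrite b2; apply: mula.
have key b c : b \in U -> (c.2 < part_at la c.1)%N -> same_letter_svt b c.
  move=> /bU2 bn cla; apply/implyP => /eqP b2; rewrite leqNgt; apply/negP => bc.
  have lac := part_at_le_trans pla bc.
  have := leq_trans cla lac; rewrite -b2; case/orP: bn => /andP[h1 h2]; last lia.
  move=> bla; have /andP[_ /= lamu] := hs b.1.+1.
  by have := leq_trans bla lamu; rewrite ltnNge h1.
split.
  apply/extendsP; split=> b c bUi; last by move=> /Ula; apply: key.
  rewrite inE => cmu; rewrite /above_left.
  rewrite [_ ==> _](key b c bUi (leq_trans cmu (mula _))) /=.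
  apply/implyP => /eqP b1; move: cmu; rewrite -b1.
  case/orP: (bU2 b bUi) => /andP[]; last by move=> /eqP<- _; rewrite ltnS.
  by move=> h _ cmu; apply: ltnW (leq_trans cmu h).
apply/eqP/setP => b; rewrite !inE; apply/orP/idP => [[/Ula//|h]|bla].
  exact: leq_trans h (mula _).
by case: (leqP (part_at mu b.1) b.2) => h; [left; apply: bU1; apply/andP|right].
Qed.

Lemma step_sum_svt (R : comNzRingType) (z x : R) mu la :
  is_partition mu -> is_partition la ->
  step_sum (@above_left L W) same_letter_svt (fun U => #|U|)
    (fun U A => (- z) ^+ #|U :&: A|) x mu la
  = if hstrip mu la then up_weight z x mu la else 0.
Proof.
move=> pmu pla; rewrite /step_sum.
under eq_bigl => U do rewrite extends_svt //.
case: ifP => [/hstripP hs|_]; last by rewrite big_pred0.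
pose F b : R := if new_box mu la b then x else
                if free_corner mu la b then - (z * x) else 0.
pose G b : R := if new_box mu la b then 0 else 1.
have nfree b : free_corner mu la b -> new_box mu la b = false.
  by move=> /andP[/eqP bmu _]; rewrite /new_box -bmu ltnn.
(* Expanding this product over boxes chooses [F] on [U] and [G] off [U]. New boxes give [x], free
   corners [1 - z * x], all others 1, and the inadmissible [U] contribute 0. *)
transitivity (\prod_b (F b + G b)).
  rewrite bigA_distr big_mkcond /=; apply: eq_bigr => U _.
  case: ifP => [/forallP bU|/negbT].
    rewrite -!prodr_const big_mkcond /= [X in _ * X]big_mkcond /= -big_split /=.
    apply: eq_bigr => b _; rewrite !inE /F /G.
    have /andP[/implyP b1 /implyP b2] := bU b.
    case: (boolP (b \in U)) => [/b2|bU'] /=; last first.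
      by case: ifP => [/b1|_]; [rewrite (negPf bU')|rewrite mulr1].
    move=> nf; case: (boolP (new_box mu la b)) nf => [nb _|_ /= fr].
      by move: nb; rewrite /new_box => /andP[h _]; rewrite ltnNge h mul1r.
    rewrite fr; move: fr; rewrite /free_corner => /andP[/eqP<- _].
    by rewrite ltnSn mulNr.
  rewrite negb_forall => /existsP[b]; rewrite negb_and !negb_imply => h.
  rewrite (bigD1 b) //= /F /G; case/orP: h => /andP[h1 h2].
    by rewrite (negPf h2) h1 mul0r.
  move: h2; rewrite negb_or h1 => /andP[/negPf-> /negPf->].
  by rewrite mul0r.
rewrite -(pair_bigA _ (fun i j => F (i, j) + G (i, j))) /=.
apply: eq_bigr => i _.
rewrite -(@prod_between W) ?part_at_le // -(@prod_last W) ?part_at_le //.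
rewrite -big_split /=; apply: eq_bigr => j _; rewrite /F /G.
case: (boolP (free_corner _ _ _)) => fr.
  rewrite (nfree _ fr); move: (nfree _ fr) (fr).
  by rewrite /new_box /free_corner /= => -> ->; rewrite mul1r addrC.
rewrite [X in _ * (if X then _ else _)](negPf fr) mulr1 /new_box /=.
by case: ifP => _; rewrite ?addr0 ?add0r.
Qed.

Lemma level_sum_svt (R : comNzRingType) (z : R) xs la : is_partition la ->
  level_sum (@above_left L W) same_letter_svt (fun U => #|U|)
    (fun U A => (- z) ^+ #|U :&: A|) xs la = up_chain z xs la.
Proof.
elim: xs la => [|x xs IH] la pla; first by rewrite level_sum_nil.
rewrite level_sum_cons // => [|U A]; last exact: extends_partition.
under eq_bigr => mu pmu do rewrite step_sum_svt // IH //.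
rewrite big_mkcond [RHS]big_mkcond /=; apply: eq_bigr => mu _.
case: (boolP (hstrip mu la)) => [/hstrip_partition_inner->//|_].
by rewrite mul0r if_same.
Qed.

(** Excluding [b = c] allows one letter per box. The level set of the largest letter is then forced
    to be the whole skew shape, so a single down step has no choice left. *)
Definition smaller_rpp b c : bool := (b != c) && above_left b c.
Definition same_letter_rpp b c : bool := true.

Definition columns U : {set 'I_W} := [set b.2 | b in U].

Definition repeats U : {set grid} :=
  [set b in U | [exists c in U, (c.1 == b.1.+1 :> nat) && (c.2 == b.2)]].

Lemma extends_rpp mu la U : is_partition mu -> is_partition la ->
  extends smaller_rpp same_letter_rpp U (boxes mu)
    && (U :|: boxes mu == boxes la)
  = contains la mu && (U == boxes la :\: boxes mu).
Proof.
move=> pmu pla; apply/andP/andP => [[/extendsP[rU _] /eqP Ula]|[/containsP h /eqP->]].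
  split; last first.
    rewrite -Ula setDUl setDv setU0 eqEsubset subsetDl andbT.
    apply/subsetP => b bU; rewrite inE bU andbT; apply/negP => bmu.
    by have /andP[] := rU b b bU bmu; rewrite eqxx.
  apply/containsP => i; rewrite leqNgt; apply/negP => /grid_box[b [bmu b1 b2]].
  have : b \in boxes la by rewrite -Ula inE bmu orbT.
  by rewrite inE b1 b2 ltnn.
split.
  apply/extendsP; split=> // b c; rewrite !inE -leqNgt => /andP[mub lab] cmu.
  apply/andP; split; first by apply: contraTneq cmu => <-; rewrite -leqNgt.
  rewrite /above_left; apply/andP; split; apply/implyP => /eqP e.
    rewrite leqNgt; apply/negP => /ltnW/(part_at_le_trans pmu).
    by move: mub cmu; rewrite e; lia.
  by move: mub cmu; rewrite e; lia.
rewrite setUC eqEsubset; apply/andP; split; apply/subsetP => b; rewrite !inE.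
  by case/orP => [bmu|/andP[]//]; apply: leq_trans bmu (h _).
by move=> ->; rewrite andbT orbN.
Qed.

Lemma card_columns_skew mu la : is_partition mu -> is_partition la ->
  contains la mu ->
  #|columns (boxes la :\: boxes mu)| = (\sum_(i < L.+1)
     (part_at la i - maxn (part_at mu i) (part_at la i.+1)))%N.
Proof.
move=> pmu pla /containsP mula; set D := _ :\: _.
have DE b : (b \in D) = (part_at mu b.1 <= b.2 < part_at la b.1)%N.
  by rewrite !inE -leqNgt.
rewrite -(@card_between L W (fun i => maxn (part_at mu i) (part_at la i.+1))
  (part_at la)) => [|i]; last exact: part_at_le.
set B := [set b : grid | _].
have Binj : {in B &, injective (fun b : grid => b.2)}.
  suff le b c : b \in B -> c \in B -> b.2 = c.2 -> (c.1 <= b.1)%N.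
    move=> b c bB cB bc; apply: eq_grid; last by rewrite bc.
    by apply/eqP; rewrite eqn_leq !le.
  rewrite !inE => hb hc bc; rewrite leqNgt; apply/negP => /(part_at_le_trans pla).
  by move: hb hc; rewrite bc; lia.
rewrite -(card_in_imset Binj); apply: eq_card => j.
apply/imsetP/imsetP => -[b bD ->]; last first.
  by exists b => //; rewrite DE; move: bD; rewrite inE; lia.
have Pb : (b \in D) && (b.2 == b.2) by rewrite bD eqxx.
(* The lowest box of the skew shape in the column of [b] represents that column. *)
case: (@arg_maxnP _ b (fun c => (c \in D) && (c.2 == b.2)) (fun c : grid => c.1) Pb).
move=> c /andP[cD /eqP cb] cmax; exists c => //.
move: (cD); rewrite DE inE geq_max => /andP[mc ->]; rewrite mc !andbT /=.
rewrite leqNgt; apply/negP => /grid_box [c' [+ c1 c2]]; rewrite inE => c'la.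
have : (c'.1 <= c.1)%N.
  apply: cmax; rewrite DE c'la andbT c1 c2; apply/andP; split.
    exact: leq_trans (is_partitionP _ pmu _) mc.
  by rewrite -cb -val_eqE /= c2.
by rewrite c1 ltnn.
Qed.

(** A box of row i in the skew shape has the box below it in the shape as well exactly when its
    column lies between [part_at mu i] and [part_at la i.+1]. *)
Lemma card_repeats_skew mu la : is_partition mu -> is_partition la ->
  contains la mu ->
  #|repeats (boxes la :\: boxes mu)|
  = (\sum_(i < L.+1) (part_at la i.+1 - part_at mu i))%N.
Proof.
move=> pmu pla /containsP mula.
rewrite -(@card_between L W (part_at mu) (fun i => part_at la i.+1)) => [|i];
  last exact: part_at_le.
apply: eq_card => b; rewrite !inE -leqNgt; apply/andP/andP.
  case=> /andP[mub bla] /existsP[c /andP[]]; rewrite !inE => /andP[_ cla].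
  by move=> /andP[/eqP c1 /eqP c2]; split; rewrite // -c1 -c2.
case=> mub bla; rewrite mub (leq_trans bla (is_partitionP _ pla _)); split=> //.
have [c [cla c1 c2]] := grid_box bla; apply/existsP; exists c.
rewrite inE cla andbT inE c1 c2 eqxx -leqNgt -val_eqE /= c2 eqxx !andbT.
exact: leq_trans (is_partitionP _ pmu _) mub.
Qed.

Lemma step_sum_rpp (R : comNzRingType) (z y : R) mu la :
  is_partition mu -> is_partition la ->
  step_sum smaller_rpp same_letter_rpp (fun U => #|columns U|)
    (fun U A => z ^+ #|repeats U|) y mu la
  = if contains la mu then down_weight z y la mu else 0.
Proof.
move=> pmu pla; rewrite /step_sum.
under eq_bigl => U do rewrite extends_rpp //.
case: ifP => mula /=; last by rewrite big_pred0.
rewrite big_pred1_eq card_columns_skew // card_repeats_skew //.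
by rewrite /down_weight big_split /= !prodrXr mulrC.
Qed.

Lemma level_sum_rpp (R : comNzRingType) (z : R) ys la : is_partition la ->
  level_sum smaller_rpp same_letter_rpp (fun U => #|columns U|)
    (fun U A => z ^+ #|repeats U|) ys la = down_chain z ys la (fun=> 1).
Proof.
elim: ys la => [|y ys IH] la pla; first by rewrite level_sum_nil /= mulr1.
rewrite level_sum_cons // => [|U A]; last first.
  by apply: extends_partition => // b c /andP[].
under eq_bigr => mu pmu do rewrite step_sum_rpp // IH //.
rewrite /= big_mkcond [RHS]big_mkcond /=; apply: eq_bigr => mu _.
by case: (is_partition mu) => //=; case: ifP; rewrite ?mul0r.
Qed.

End Steps.

From mathcomp Require Import boolp classical_sets functions cardinality fsbigop.

(** * Tableaux and their level sets *)

Lemma fsum_finite (V : nmodType) (T : finType) (P : pred T) (f : T -> V) :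
  \sum_(t \in [set` P]%classic) f t = \sum_(t | P t) f t.
Proof.
rewrite -(@bigfs _ _ _ _ (index_enum T)) ?index_enum_uniq // => i _.
by rewrite mem_index_enum.
Qed.

Section Levels.
Variables (L W : nat) (la : seq nat).
Hypotheses (dla : is_diagram la) (laW : first_row la = W).
Hypothesis laL : (size la <= L.+1)%N.
Local Notation grid := (grid L W).
Implicit Types (b c : box la) (P : {ffun box la -> {fset nat}}).

Lemma nth_diagram_le i j : (i <= j)%N -> (nth 0 la j <= nth 0 la i)%N.
Proof.
case/andP: dla => sla _ ij; case: (ltnP j (size la)) => js; last first.
  by rewrite nth_default.
have gT : transitive geq by move=> x y z /= yx zx; apply: leq_trans zx yx.
apply: (sorted_leq_nth gT leqnn 0%N sla) => //.
by rewrite inE; apply: leq_ltn_trans js.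
Qed.

Definition seq_vec : vec L W := [ffun i : 'I_L.+1 => inord (nth 0%N la i)].

Lemma part_at_seq_vec i : part_at seq_vec i = nth 0%N la i.
Proof.
case: (leqP i L) => iL; last first.
  by rewrite part_at_large // nth_default //; apply: leq_trans laL iL.
rewrite -[i]/(val (Ordinal (iL : i < L.+1)%N)) part_atE ffunE inordK //=.
by rewrite ltnS -laW; apply: nth_diagram_le.
Qed.

Lemma is_partition_seq_vec : is_partition seq_vec.
Proof.
by apply/is_partitionP => i; rewrite !part_at_seq_vec nth_diagram_le.
Qed.

Lemma row_ltL b : (Defs.row b < L.+1)%N.
Proof. exact: leq_trans (ltn_ord _) laL. Qed.

Lemma col_ltW b : (Defs.col b < W)%N.
Proof. by rewrite -laW; apply: col_lt_first_row. Qed.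

Definition cell b : grid := (Ordinal (row_ltL b), Ordinal (col_ltW b)).

Lemma cell_inj : injective cell.
Proof.
move=> [i j] [i' j'] e.
have /val_inj ii' : i = i' :> nat := congr1 (fun g : grid => nat_of_ord g.1) e.
have jj' : j = j' :> nat := congr1 (fun g : grid => nat_of_ord g.2) e.
by subst i'; congr existT; apply: val_inj.
Qed.

Lemma cell_boxes b : cell b \in boxes seq_vec.
Proof. by rewrite inE part_at_seq_vec /=; apply: (ltn_ord (tagged b)). Qed.

Lemma boxes_cell (g : grid) : g \in boxes seq_vec -> exists b, cell b = g.
Proof.
rewrite inE part_at_seq_vec => gla.
have gs : (g.1 < size la)%N.
  by rewrite ltnNge; apply/negP => sg; rewrite nth_default in gla.
exists (Tagged (fun i : 'I_(size la) => 'I_(nth 0%N la i))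
  (Ordinal (gla : g.2 < nth 0%N la (Ordinal gs))%N)).
exact: eq_grid.
Qed.

Lemma card_boxes_seq_vec : #|boxes seq_vec| = #|{: box la}|.
Proof.
rewrite -(card_imset _ cell_inj); apply: eq_card => g.
apply/idP/imsetP => [/boxes_cell[b <-]|[b _ ->]]; first by exists b.
exact: cell_boxes.
Qed.

Definition level P k : {set grid} := cell @: [set b | k \in P b].

Lemma mem_level P k b : (cell b \in level P k) = (k \in P b).
Proof. by rewrite (mem_imset _ _ cell_inj) inE. Qed.

Lemma level_boxes P k g : g \in level P k -> g \in boxes seq_vec.
Proof. by case/imsetP=> b _ ->; apply: cell_boxes. Qed.

(* Listed from the largest letter down, so that the head of the sequence is the
   last step of the chain of shapes. *)
Definition letters N P : seq {set grid} :=
  mkseq (fun i => level P (N - i.+1)%N) N.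

Definition tableau_of N (t : seq {set grid}) : {ffun box la -> {fset nat}} :=
  [ffun b => [fset k in iota 0 N | cell b \in nth finset.set0 t (N - k.+1)%N]%fset].

Lemma mem_tableau_of N t b k :
  (k \in tableau_of N t b) = (k < N)%N && (cell b \in nth finset.set0 t (N - k.+1)%N).
Proof. by rewrite ffunE !inE /= mem_iota. Qed.

Lemma nth_letters N P i : nth finset.set0 (letters N P) i =
  if (i < N)%N then level P (N - i.+1)%N else finset.set0.
Proof.
case: ltnP => iN; first by rewrite nth_mkseq.
by rewrite nth_default // size_mkseq.
Qed.

Lemma tableau_of_letters N P :
  (forall b k, k \in P b -> (k < N)%N) -> tableau_of N (letters N P) = P.
Proof.
move=> PN; apply/ffunP => b; apply/fsetP => k; rewrite mem_tableau_of.
case: ltnP => kN /=; last by apply/esym/negbTE/negP => /PN; rewrite ltnNge kN.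
rewrite nth_letters ifT ?mem_level; last by lia.
by have -> : (N - (N - k.+1).+1 = k)%N by lia.
Qed.

Lemma level_tableau_of N t k : (k < N)%N -> cup t = boxes seq_vec ->
  level (tableau_of N t) k = nth finset.set0 t (N - k.+1)%N.
Proof.
move=> kN tla; apply/setP => g; apply/idP/idP => [/imsetP[b]|gt].
  by rewrite inE mem_tableau_of => /andP[_ bt] ->.
have [|b bg] := @boxes_cell g; first by rewrite -tla; apply/cupP; exists (N - k.+1)%N.
by rewrite -bg mem_level mem_tableau_of kN bg.
Qed.

Lemma letters_tableau_of N t : size t = N -> cup t = boxes seq_vec ->
  letters N (tableau_of N t) = t.
Proof.
move=> tN tla; apply: (@eq_from_nth _ finset.set0); first by rewrite size_mkseq.
move=> i; rewrite size_mkseq => iN; rewrite nth_letters iN level_tableau_of //.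
  by congr nth; lia.
by lia.
Qed.

Section Bijection.
Variables (r q : rel grid) (e : {set grid} -> nat) (N : nat) (a : nat -> nat).

(** A common model of both families with [N] letters: [r] and [q] encode the order conditions, and
    [e] the statistic of a level set that is prescribed by [a], namely its size or its number of
    columns. *)
Definition tableaux : set {ffun box la -> {fset nat}} :=
  [set P : {ffun box la -> {fset nat}} |
  [/\ forall b k, k \in P b -> (k < N)%N,
      forall b, P b != fset0,
      forall b c k l, (l < k)%N -> k \in P b -> l \in P c -> r (cell b) (cell c),
      forall b c k, k \in P b -> k \in P c -> q (cell b) (cell c)
    & forall k, (k < N)%N -> e (level P k) = a k]]%classic.

Definition contents : seq nat := mkseq (fun i => a (N - i.+1)%N) N.

Definition level_tuples (t : N.-tuple {set grid}) : bool :=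
  [&& admissible r q t, cup t == boxes seq_vec & map e t == contents].

Lemma tableaux_letters P : tableaux P ->
  [/\ admissible r q (letters N P), cup (letters N P) = boxes seq_vec
    & map e (letters N P) = contents].
Proof.
move=> [PN P0 Pr Pq Pe]; split.
- apply/admissibleP; split=> [i j b c ij|i b c]; rewrite !nth_letters.
    case: ifP => iN; last by rewrite inE.
    case: ifP => jN; last by rewrite inE.
    case/imsetP=> b' + -> /imsetP[c' + ->]; rewrite !inE.
    by apply: Pr; lia.
  case: ifP => iN; last by rewrite inE.
  case/imsetP=> b' + -> /imsetP[c' + ->]; rewrite !inE; exact: Pq.
- apply/setP => g; apply/cupP/idP => [[i]|/boxes_cell[b <-]].
    by rewrite nth_letters; case: ifP => _; [exact: level_boxes|rewrite inE].
  have /fset0Pn[k kP] := P0 b; have kN := PN _ _ kP.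
  exists (N - k.+1)%N; rewrite nth_letters ifT ?mem_level; last by lia.
  by rewrite (_ : (N - _ = k)%N) //; lia.
- rewrite /letters /contents /mkseq -map_comp; apply/eq_in_map => i.
  by rewrite mem_iota => /andP[_ iN] /=; apply: Pe; lia.
Qed.

Lemma tableau_of_tableaux (t : N.-tuple {set grid}) :
  level_tuples t -> tableaux (tableau_of N t).
Proof.
move=> /and3P[/admissibleP[tr tq] /eqP tla /eqP te]; split.
- by move=> b k; rewrite mem_tableau_of => /andP[].
- move=> b; have := cell_boxes b; rewrite -tla => /cupP[i bi].
  have iN : (i < N)%N.
    by rewrite ltnNge; apply/negP => Ni; rewrite nth_default ?inE ?size_tuple in bi.
  apply/fset0Pn; exists (N - i.+1)%N; rewrite mem_tableau_of.
  by rewrite (_ : (N - (N - i.+1).+1 = i)%N) ?bi ?andbT; lia.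
- move=> b c k l lk; rewrite !mem_tableau_of => /andP[kN bk] /andP[lN cl].
  by apply: (tr _ _ _ _ _ bk cl); lia.
- move=> b c k; rewrite !mem_tableau_of => /andP[_ bk] /andP[_ ck].
  exact: (tq _ _ _ bk ck).
- move=> k kN; rewrite level_tableau_of // -(nth_map _ 0%N) ?size_tuple; last lia.
  rewrite te nth_mkseq; last by lia.
  by congr a; lia.
Qed.

Lemma sum_tableaux (V : nmodType) (F : seq {set grid} -> V) :
  \sum_(P \in tableaux) F (letters N P) = \sum_(t | level_tuples t) F t.
Proof.
rewrite -fsum_finite.
rewrite (@reindex_fsbig _ _ _ _ _ (fun t : N.-tuple {set grid} => tableau_of N t)
  [set` level_tuples]%classic).
  apply: eq_fsbigr => t; rewrite inE /= => /and3P[_ /eqP tla _].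
  by rewrite letters_tableau_of // size_tuple.
split=> [t /=|t t'|P tP].
- exact: tableau_of_tableaux.
- rewrite !inE => /and3P[_ /eqP tla _] /and3P[_ /eqP tla' _] tt'.
  by apply: val_inj; rewrite -[LHS](letters_tableau_of (size_tuple t) tla) tt'
     letters_tableau_of ?size_tuple.
- have [h1 h2 h3] := tableaux_letters tP; have [PN _ _ _ _] := tP.
  have sz : size (letters N P) == N by rewrite size_mkseq.
  exists (Tuple sz); last exact: tableau_of_letters.
  by apply/and3P; split=> //=; apply/eqP.
Qed.

End Bijection.
End Levels.

(** * One-parameter families *)

Definition grothendieck_at (z : {poly int}) (la : seq nat) : series :=
  genfun [set P | @is_svt la P]%classic (fun P => (- z) ^+ svt_excess P)
    (@svt_wt la).

Definition dual_grothendieck_at (z : {poly int}) (la : seq nat) : series :=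
  genfun [set Q | @is_rpp la Q]%classic (fun Q => z ^+ rpp_repeats Q)
    (@rpp_wt la).

Section Singletons.
Variable la : seq nat.
Implicit Types (b c : box la) (T : {ffun box la -> nat}).
Implicit Types (P : {ffun box la -> {fset nat}}).

Definition singletons T : {ffun box la -> {fset nat}} :=
  [ffun b => [fset T b]%fset].

Lemma mem_singletons T b k : (k \in singletons T b) = (k == T b).
Proof. by rewrite ffunE inE. Qed.

Lemma singletons_inj : injective singletons.
Proof.
move=> T T' e; apply/ffunP => b; apply/eqP.
by rewrite -mem_singletons -e mem_singletons.
Qed.

Lemma singletonsP P : (forall b, P b != fset0) ->
  (forall b k l, k \in P b -> l \in P b -> k = l) -> exists T, P = singletons T.
Proof.
move=> P0 P1; have h b : exists k, k \in P b by apply/fset0Pn.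
exists [ffun b => xchoose (h b)]; apply/ffunP => b; apply/fsetP => k.
rewrite mem_singletons ffunE; have hb := xchooseP (h b).
by apply/idP/eqP => [kP|->//]; apply: (P1 b).
Qed.

Lemma exists_box i j : (j < nth 0%N la i)%N ->
  exists b, Defs.row b = i /\ Defs.col b = j.
Proof.
move=> jla; have il : (i < size la)%N.
  by rewrite ltnNge; apply/negP => li; rewrite nth_default in jla.
by exists (Tagged (fun i : 'I_(size la) => 'I_(nth 0%N la i))
  (Ordinal (jla : j < nth 0%N la (Ordinal il))%N)).
Qed.

Lemma eq_box b c : Defs.row b = Defs.row c -> Defs.col b = Defs.col c -> b = c.
Proof.
case: b c => [i j] [i' j'] /val_inj /= ii'; subst i' => /val_inj /= jj'.
by congr existT.
Qed.

Lemma is_svt_singletons T : is_svt (singletons T) <-> is_cst T.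
Proof.
split=> [[_ h1 h2]|[h1 h2]].
  split=> b c e1 e2; [apply: (h1 b c e1 e2)|apply: (h2 b c e1 e2)];
    by rewrite mem_singletons.
split=> [b|b c e1 e2 k l|b c e1 e2 k l].
- by apply/fset0Pn; exists (T b); rewrite mem_singletons.
- by rewrite !mem_singletons => /eqP-> /eqP->; apply: h1.
- by rewrite !mem_singletons => /eqP-> /eqP->; apply: h2.
Qed.

Lemma svt_wt_singletons T k : svt_wt (singletons T) k = cst_wt T k.
Proof. by apply: eq_card => b; rewrite !inE mem_singletons eq_sym. Qed.

Lemma svt_excess_singletons T : svt_excess (singletons T) = 0%N.
Proof. by rewrite /svt_excess big1 // => b _; rewrite ffunE cardfs1. Qed.

Lemma svt_excess_eq0 P : is_svt P -> svt_excess P = 0%N ->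
  exists T, P = singletons T.
Proof.
case=> P0 _ _ /eqP; rewrite /svt_excess sum_nat_eq0 => /forallP e0.
apply: singletonsP => // b k l kP lP.
have : (#|` P b| <= 1)%N by have := e0 b; rewrite implyTb subn_eq0.
have [x xP] := fset0Pn _ (P0 b).
rewrite (cardfsD1 k) kP ltnS leqn0 cardfs_eq0 => /eqP/fsetP/(_ l).
by rewrite !inE lP andbT => /negbFE/eqP.
Qed.

(** A power of 0 kills every tableau of positive excess; what survives has one letter in each
    box. *)
Lemma grothendieck_at0 : grothendieck_at 0 la = schur la.
Proof.
apply/funext => a; rewrite /grothendieck_at /schur /genfun.
set A := (X in \sum_(t \in X) 1).
rewrite -(@fsbig_widen _ _ _ _ (singletons @` A)%classic); first last.
- move=> P [[/= Psvt Pw] nA]; rewrite oppr0 expr0n.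
  case: eqP => // /(svt_excess_eq0 Psvt)[T PT]; case: nA.
  exists T => //; rewrite PT in Psvt Pw.
  split; first exact/is_svt_singletons.
  by move=> k; rewrite -svt_wt_singletons.
- move=> _ [T [/= Tc Tw] <-]; split; first exact/is_svt_singletons.
  by move=> k; rewrite svt_wt_singletons.
rewrite fsbig_image; last by move=> T T' _ _; apply: singletons_inj.
by apply: eq_fsbigr => T _; rewrite svt_excess_singletons expr0.
Qed.

(** In a column-strict tableau the boxes holding [k] lie in distinct columns, so counting columns is
    counting boxes. *)
Lemma rpp_wt_cst T k : is_diagram la -> is_cst T -> rpp_wt T k = cst_wt T k.
Proof.
move=> dla [Tcol _].
pose colo b : 'I_(first_row la) := Ordinal (col_lt_first_row b dla).
rewrite /cst_wt -(@card_in_imset _ _ colo [pred b | T b == k]).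
  apply: eq_card => j; rewrite inE; apply/existsP/imsetP.
    by move=> [b /andP[/eqP bj Tb]]; exists b => //; apply: val_inj.
  by move=> [b Tb ->]; exists b; rewrite eqxx.
suff le b c : T b = k -> T c = k -> Defs.col b = Defs.col c ->
    (Defs.row b <= Defs.row c)%N.
  move=> b c; rewrite !inE => /eqP Tb /eqP Tc /(congr1 val) bc.
  apply: (eq_box _ bc); apply/eqP.
  by rewrite eqn_leq (le b c Tb Tc bc) (le c b Tc Tb (esym bc)).
move=> Tb Tc bc; rewrite leqNgt; apply/negP => /(Tcol c b (esym bc)).
by rewrite Tb Tc ltnn.
Qed.

Lemma rpp_repeats_cst T : is_diagram la -> is_rpp T ->
  rpp_repeats T = 0%N <-> is_cst T.
Proof.
move=> dla [Tcol Trow]; split=> [/card0_eq rep0|[Ts _]].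
  split=> // b c bc1 bc2.
  (* Repeats concern only vertical neighbours. Strictness is obtained from [b] to the box [d] just
     below it, and weak monotonicity carries it down to [c]. *)
  have [|d [d1 d2]] := @exists_box (Defs.row b).+1 (Defs.col b).
    apply: leq_trans (nth_diagram_le dla bc2); rewrite bc1.
    exact: ltn_ord (tagged c).
  have bd : T b != T d.
    apply/eqP => Tbd; have := rep0 b; rewrite inE => /existsP[]; exists d.
    by rewrite d1 d2 Tbd !eqxx.
  have Tbd : (T b <= T d)%N by apply: Tcol; rewrite ?d2 ?d1.
  apply: (@leq_trans (T d)); first by rewrite ltn_neqAle bd.
  move: bc2; rewrite -d1 leq_eqVlt => /predU1P[dc|dc].
    by rewrite (@eq_box d c) // d2.
  by apply: Tcol => //; rewrite d2.
apply/eqP; rewrite eqn0Ngt; apply/card_gt0P => -[b]; rewrite inE.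
move=> /existsP[c /and3P[/eqP c1 /eqP c2 /eqP Tbc]].
by have := Ts b c; rewrite c1 c2 Tbc ltnn ltnSn => /(_ erefl isT).
Qed.

Lemma dual_grothendieck_at0 : is_diagram la -> dual_grothendieck_at 0 la = schur la.
Proof.
move=> dla; apply/funext => a; rewrite /dual_grothendieck_at /schur /genfun.
set A := (X in \sum_(t \in X) 1).
have cst_rpp T : is_cst T -> is_rpp T.
  by case=> h1 h2; split=> // b c e1 e2; apply: ltnW; apply: h1.
rewrite -(@fsbig_widen _ _ _ _ A).
- apply: eq_fsbigr => T; rewrite inE => -[/= Tc _].
  by rewrite (rpp_repeats_cst dla (cst_rpp _ Tc)).2.
- move=> T [/= Tc Tw]; split; first exact: cst_rpp.
  by move=> k; rewrite rpp_wt_cst.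
- move=> T [[/= Tr Tw] nA]; rewrite expr0n; case: eqP => // /rpp_repeats_cst Tc.
  case: nA; have {}Tc := Tc dla Tr.
  by split=> // k; rewrite -rpp_wt_cst.
Qed.

End Singletons.

Section Coefficients.
Variables (L W : nat) (R : comNzRingType) (z : R).
Implicit Types s : seq {set grid L W}.

(** Each overlap is the surplus of the sizes of two sets over the size of their union. The additive
    form avoids subtraction and matches [svt_excess_letters]: excess plus number of boxes is the
    total number of entries. *)
Lemma coeff_svt s : exists2 n, coeff (fun U A => z ^+ #|U :&: A|) s = z ^+ n
  & (n + #|cup s| = sumn (map (fun U : {set grid L W} => #|U|) s))%N.
Proof.
elim: s => [|U s [n IH1 IH2]] /=.
  by exists 0%N => //; rewrite /cup big_nil cards0.
exists (#|U :&: cup s| + n)%N; first by rewrite IH1 exprD.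
rewrite -IH2 cup_cons cardsU addnAC subnKC ?[(n + _)%N]addnC ?addnA //.
exact: leq_trans (subset_leq_card (finset.subsetIl U (cup s))) (leq_addr _ _).
Qed.

Lemma coeff_rpp s :
  coeff (fun U A => z ^+ #|repeats U|) s = z ^+ sumn (map (fun U : {set grid L W} => #|repeats U|) s).
Proof. by elim: s => //= U s ->; rewrite exprD. Qed.

End Coefficients.

Lemma sumn_mkseq_rev (f : nat -> nat) N :
  sumn (mkseq (fun i => f (N - i.+1)%N) N) = (\sum_(k < N) f k)%N.
Proof.
rewrite /mkseq; have -> : iota 0 N = index_iota 0 N by rewrite /index_iota subn0.
rewrite sumnE big_map big_nat_rev big_mkord /=.
by apply: eq_bigr => k _; congr f; have := ltn_ord k; lia.
Qed.

(** * Coefficients of both families as sums over level sets *)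

Section LevelExpansion.
Variables (L W : nat) (la : seq nat).
Hypotheses (dla : is_diagram la) (laW : first_row la = W).
Hypothesis laL : (size la <= L.+1)%N.
Variables (N : nat) (a : monomial) (z : {poly int}).
Hypothesis aN : forall k, k \in finsupp a -> (k < N)%N.
Local Notation cell := (cell dla laW laL).
Local Notation level := (level dla laW laL).
Local Notation letters := (letters dla laW laL).
Implicit Types (b c : box la) (P : {ffun box la -> {fset nat}}).

Lemma monomial_large k : (N <= k)%N -> a k = 0%N.
Proof.
move=> Nk; apply: fsfun_dflt; apply/negP => /aN.
by rewrite ltnNge Nk.
Qed.

Lemma card_level P k : #|level P k| = svt_wt P k.
Proof. by rewrite card_imset ?cardsE //; apply: cell_inj. Qed.

Lemma above_left_cell b c : above_left (cell b) (cell c) =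
  ((Defs.col b == Defs.col c) ==> (Defs.row c <= Defs.row b)%N)
  && ((Defs.row b == Defs.row c) ==> (Defs.col c <= Defs.col b)%N).
Proof. by []. Qed.

Lemma svt_tableaux :
  ([set P | @is_svt la P] `&` has_weight (@svt_wt la) a)%classic =
  tableaux dla laW laL (@above_left L W) (@same_letter_svt L W)
    (fun U : {set grid L W} => #|U|) N a.
Proof.
apply/seteqP; split=> P /=.
  case=> -[P0 Pcol Prow] Pw; split=> //.
  - move=> b k kP; apply/aN/in_finsupp; rewrite -Pw.
    by apply/card_gt0P; exists b; rewrite inE.
  - move=> b c k l lk kb lc; rewrite above_left_cell; apply/andP; split;
      apply/implyP => /eqP e; rewrite leqNgt; apply/negP => h.
      by have := Pcol b c e h k l kb lc; rewrite ltnNge (ltnW lk).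
    by have := Prow b c e h k l kb lc; rewrite leqNgt lk.
  - move=> b c k kb kc; apply/implyP => /eqP/(congr1 val) /= e.
    rewrite leqNgt; apply/negP => h.
    by have := Pcol b c e h k k kb kc; rewrite ltnn.
  - by move=> k kN; rewrite card_level Pw.
case=> PN P0 Pr Pq Pe; split.
  split=> // b c e1 e2 k l kb lc; last first.
    rewrite leqNgt; apply/negP => lk.
    have := Pr b c k l lk kb lc; rewrite above_left_cell => /andP[_].
    by rewrite e1 eqxx /= leqNgt e2.
  rewrite ltnNge; apply/negP; rewrite leq_eqVlt => /predU1P[kl|lk].
    subst l; have /implyP := Pq b c k kb lc.
    by rewrite -val_eqE /= e1 eqxx leqNgt e2 => /(_ isT).
  have := Pr b c k l lk kb lc; rewrite above_left_cell => /andP[+ _].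
  by rewrite e1 eqxx /= leqNgt e2.
move=> k; case: (ltnP k N) => kN; first by rewrite -card_level Pe.
rewrite monomial_large //; apply: eq_card0 => b; rewrite !inE.
by apply/negbTE/negP => /PN; rewrite ltnNge kN.
Qed.

Lemma card_fset_below (A : {fset nat}) : (forall k, k \in A -> (k < N)%N) ->
  #|` A| = (\sum_(k < N) (nat_of_bool (val k \in A)))%N.
Proof.
move=> AN; rewrite -(big_mkord xpredT (fun k => nat_of_bool (k \in A))) -big_mkcond.
rewrite sum1_count -size_filter; apply: perm_size; apply: uniq_perm.
- exact: fset_uniq.
- by rewrite filter_uniq ?iota_uniq.
move=> k; rewrite mem_filter mem_index_iota /=.
by case: (boolP (k \in A)) => [/AN|].
Qed.

Lemma svt_excess_letters P : (forall b k, k \in P b -> (k < N)%N) ->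
  (forall b, P b != fset0) ->
  (svt_excess P + #|{: box la}| = sumn (map (fun U : {set grid L W} => #|U|) (letters N P)))%N.
Proof.
move=> PN P0; rewrite /letters /mkseq -map_comp.
rewrite (sumn_mkseq_rev (fun k => #|level P k|)).
rewrite /svt_excess -sum1_card -big_split /=.
transitivity (\sum_b #|` P b|)%N.
  by apply: eq_bigr => b _; rewrite subnK // cardfs_gt0.
rewrite (eq_bigr _ (fun b _ => card_fset_below (PN b))) exchange_big /=.
apply: eq_bigr => k _; rewrite card_level /svt_wt -sum1_card [RHS]big_mkcond /=.
by apply: eq_bigr => b _; rewrite inE; case: (_ \in _).
Qed.

Lemma grothendieck_at_levels : grothendieck_at z la a =
  \sum_(t | level_tuples la (@above_left L W) (@same_letter_svt L W)
              (fun U : {set grid L W} => #|U|) a t)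
     coeff (fun U A => (- z) ^+ #|U :&: A|) (val (t : N.-tuple {set grid L W})).
Proof.
rewrite -(sum_tableaux dla laW laL) /grothendieck_at /genfun svt_tableaux.
apply: eq_fsbigr => P; rewrite inE => tP; have [PN P0 _ _ _] := tP.
have [_ cupP _] := tableaux_letters tP.
have [n -> nE] := coeff_svt (- z) (letters N P).
congr (_ ^+ _); apply: (@addIn #|cup (letters N P)|).
by rewrite nE cupP card_boxes_seq_vec // svt_excess_letters.
Qed.

Lemma card_columns_level (Q : {ffun box la -> nat}) k :
  #|columns (level (singletons Q) k)| = rpp_wt Q k.
Proof.
rewrite /rpp_wt -(card_imset _ (@cast_ord_inj _ _ laW)); apply: eq_card => j.
apply/imsetP/imsetP => [[_ /imsetP[b + ->] ->]|[j' + ->]]; rewrite !inE.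
  rewrite mem_singletons => /eqP Qb.
  exists (Ordinal (col_lt_first_row b dla)); last exact: val_inj.
  by rewrite inE; apply/existsP; exists b; rewrite Qb !eqxx.
move=> /existsP[b /andP[/eqP bj /eqP Qb]]; exists (cell b); last exact: val_inj.
by rewrite mem_level mem_singletons Qb.
Qed.

Lemma rpp_tableaux :
  (@singletons la @` ([set Q | @is_rpp la Q] `&` has_weight (@rpp_wt la) a))%classic
  = tableaux dla laW laL (@smaller_rpp L W) (@same_letter_rpp L W)
    (fun U => #|columns U|) N a.
Proof.
apply/seteqP; split=> P /=.
  case=> Q [[Qcol Qrow] Qw] <-; split=> //.
  - move=> b k; rewrite mem_singletons => /eqP->; apply/aN/in_finsupp.
    rewrite -Qw -card_columns_level; apply/card_gt0P; exists (cell b).2.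
    by apply: imset_f; rewrite mem_level mem_singletons.
  - by move=> b; apply/fset0Pn; exists (Q b); rewrite mem_singletons.
  - move=> b c k l lk; rewrite !mem_singletons => /eqP kb /eqP lc; subst k l.
    rewrite /smaller_rpp above_left_cell; apply/and3P; split.
    + by apply: contraTneq lk => /cell_inj ->; rewrite ltnn.
    + apply/implyP => /eqP e; rewrite leqNgt; apply/negP => h.
      by have := Qcol b c e h; rewrite leqNgt lk.
    + apply/implyP => /eqP e; rewrite leqNgt; apply/negP => h.
      by have := Qrow b c e h; rewrite leqNgt lk.
  - by move=> k kN; rewrite card_columns_level Qw.
case=> PN P0 Pr _ Pe.
(* Two letters in one box would put a cell in the relation [smaller_rpp] with itself. *)
have [b k l kb lb|Q PQ] := singletonsP P0.
  case: (ltngtP k l) => // h; [have := Pr b b l k h lb kb|have := Pr b b k l h kb lb];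
    by rewrite /smaller_rpp eqxx.
subst P; exists Q => //; split.
  have rQ b c : (Q c < Q b)%N -> above_left (cell b) (cell c).
    move=> h; suff /andP[] : smaller_rpp (cell b) (cell c) by [].
    by apply: (Pr _ _ _ _ h); rewrite mem_singletons.
  split=> b c e1 e2; rewrite leqNgt; apply/negP => /rQ.
    by rewrite above_left_cell e1 eqxx /= leqNgt e2.
  by rewrite above_left_cell e1 eqxx /= andbC leqNgt e2.
move=> k; case: (ltnP k N) => kN; first by rewrite -card_columns_level Pe.
rewrite monomial_large //; apply: eq_card0 => j; rewrite !inE.
apply/existsP => -[b /andP[_ /eqP Qb]].
by have := PN b k; rewrite mem_singletons Qb eqxx => /(_ isT); rewrite ltnNge kN.
Qed.

Lemma rpp_repeats_letters (Q : {ffun box la -> nat}) :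
  (forall b, (Q b < N)%N) ->
  rpp_repeats Q = sumn (map (fun U : {set grid L W} => #|repeats U|)
                            (letters N (singletons Q))).
Proof.
move=> QN; rewrite /letters /mkseq -map_comp.
rewrite (sumn_mkseq_rev (fun k => #|repeats (level (singletons Q) k)|)).
pose B := [pred b | [exists c : box la, [&& Defs.row c == (Defs.row b).+1,
  Defs.col c == Defs.col b & Q b == Q c]]].
(* A box and the equal box below it lie in the same level set, so repeats can be counted letter by
   letter. *)
transitivity (\sum_(k < N) #|[pred b in B | Q b == k]|)%N.
  rewrite /rpp_repeats -sum1_card (partition_big (fun b => Ordinal (QN b)) xpredT) //=.
  by apply: eq_bigr => k _; rewrite sum1_card; apply: eq_card => b; rewrite !inE.
apply: eq_bigr => k _; rewrite -(card_imset _ (@cell_inj L W la dla laW laL)).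
apply: eq_card => g; rewrite [RHS]inE; apply/imsetP/andP.
  move=> [b + ->]; rewrite !inE => /andP[/existsP[c /and3P[/eqP c1 /eqP c2 /eqP Qbc]] Qb].
  rewrite mem_level mem_singletons eq_sym Qb; split=> //.
  apply/existsP; exists (cell c); rewrite mem_level mem_singletons -Qbc eq_sym Qb /=.
  by rewrite c1 eqxx -val_eqE /= c2 eqxx.
move=> [/imsetP[b + ->] /existsP[g' /and3P[/imsetP[c + ->]]]].
rewrite !inE !mem_singletons => /eqP Qb /eqP Qc /eqP c1 /eqP/(congr1 val) c2.
have {}c1 : Defs.row c = (Defs.row b).+1 := c1.
have {}c2 : Defs.col c = Defs.col b := c2.
exists b => //; rewrite !inE -Qb eqxx andbT; apply/existsP; exists c.
by rewrite c1 c2 -Qc !eqxx.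
Qed.

Lemma dual_grothendieck_at_levels : dual_grothendieck_at z la a =
  \sum_(t | level_tuples la (@smaller_rpp L W) (@same_letter_rpp L W)
              (fun U => #|columns U|) a t)
     coeff (fun U A => z ^+ #|repeats U|) (val (t : N.-tuple {set grid L W})).
Proof.
rewrite -(sum_tableaux dla laW laL) /dual_grothendieck_at /genfun -rpp_tableaux.
rewrite fsbig_image; last by move=> T T' _ _; apply: singletons_inj.
apply: eq_fsbigr => Q; rewrite inE => AQ.
have : tableaux dla laW laL (@smaller_rpp L W) (@same_letter_rpp L W)
    (fun U => #|columns U|) N a (singletons Q).
  by rewrite -rpp_tableaux; exists Q.
case=> PN _ _ _ _; rewrite coeff_rpp rpp_repeats_letters // => b.
by apply: (PN b); rewrite mem_singletons.
Qed.

End LevelExpansion.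

(** * Extracting coefficients *)

Section Kronecker.
Variable B : nat.

Definition kronecker (s : seq nat) : nat := foldr (fun d n => d + B * n)%N 0%N s.

Lemma kronecker_cat s1 s2 :
  kronecker (s1 ++ s2) = (kronecker s1 + B ^ size s1 * kronecker s2)%N.
Proof.
elim: s1 => [|d s1 IH] /=; first by rewrite expn0 mul1n.
by rewrite IH expnS mulnDr addnA mulnA.
Qed.

Lemma kronecker_inj s1 s2 : size s1 = size s2 ->
  all (fun d => d < B)%N s1 -> all (fun d => d < B)%N s2 ->
  kronecker s1 = kronecker s2 -> s1 = s2.
Proof.
elim: s1 s2 => [|d s1 IH] [|d' s2] //= [sz] /andP[dB s1B] /andP[d'B s2B] e.
have dd' : d = d'.
  have := congr1 (modn^~ B) e.
  by rewrite /= ![(_ + B * _)%N]addnC ![(B * _)%N]mulnC !modnMDl !modn_small.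
move: e; rewrite dd' => /addnI/eqP; rewrite eqn_pmul2l; last first.
  exact: leq_ltn_trans dB.
by move=> /eqP/(IH _ sz s1B s2B) ->.
Qed.

(* Substituting 'X^(B^i) for the i-th variable keeps all monomials with
   exponents below B apart. *)
Definition kronecker_vars (m N : nat) : seq {poly {poly int}} :=
  [seq 'X^(B ^ i) | i <- iota m N].

Lemma size_kronecker_vars m N : size (kronecker_vars m N) = N.
Proof. by rewrite size_map size_iota. Qed.

Lemma kronecker_vars_neq0 m N : 0 \notin kronecker_vars m N.
Proof.
apply/negP => /mapP[i _ /eqP]; rewrite eq_sym; apply/negP.
by rewrite monic_neq0 // monicXn.
Qed.

(** The offset [m] is 0 for the x-letters and [N] for the y-letters, so the two contents occupy
    consecutive blocks of digits. *)
Lemma mon_kronecker L W (e : {set grid L W} -> nat) m N (t : seq {set grid L W}) :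
  size t = N ->
  mon e (kronecker_vars m N) t = 'X^(B ^ m * kronecker (map e t)).
Proof.
elim: t m N => [|U t IH] m [|N] //=; first by rewrite muln0 expr0.
by move=> [tN]; rewrite [mon _ _ _]IH // -exprM -exprD mulnDr expnSr mulnA.
Qed.

End Kronecker.

Lemma coeff_polyC L W (S : comNzRingType)
    (f : {set grid L W} -> {set grid L W} -> S)
    (f' : {set grid L W} -> {set grid L W} -> {poly S}) s :
  (forall U A, f' U A = (f U A)%:P) -> coeff f' s = (coeff f s)%:P.
Proof. by move=> ff'; elim: s => //= U s ->; rewrite ff' polyCM. Qed.

Lemma level_sum_size L W (S : comNzRingType) r q (e : {set grid L W} -> nat)
    (f : {set grid L W} -> {set grid L W} -> S) N (xs : seq S) (la : vec L W) :
  size xs = N ->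
  level_sum r q e f xs la = \sum_(t : N.-tuple {set grid L W} |
    admissible r q t && (cup t == boxes la)) coeff f t * mon e xs t.
Proof. by move=> <-. Qed.

(** A coefficient of a product is in general a convolution. Here the exponent [k] splits in a way
    that separates the conditions on [i] and [j], so the coefficient factors. *)
Lemma coef_mul_sums (S : comNzRingType) (I J : finType) (P : pred I) (Q : pred J)
    (c : I -> S) (d : J -> S) (m : I -> nat) (n : J -> nat)
    (P' : pred I) (Q' : pred J) k :
  (forall i j, P i -> Q j -> (m i + n j == k)%N = P' i && Q' j) ->
  ((\sum_(i | P i) (c i)%:P * 'X^(m i)) * (\sum_(j | Q j) (d j)%:P * 'X^(n j)))`_k
  = (\sum_(i | P i && P' i) c i) * (\sum_(j | Q j && Q' j) d j).
Proof.
move=> mnk; rewrite !big_distrlr /= coef_sum big_mkcondr.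
apply: eq_bigr => i Pi; rewrite coef_sum; case: (boolP (P' i)) => P'i.
  rewrite big_mkcondr; apply: eq_bigr => j Qj.
  rewrite mulrACA -exprD -polyCM coefCM coefXn eq_sym mnk // P'i.
  by case: (Q' j); rewrite ?mulr1 ?mulr0.
rewrite big1 // => j Qj.
by rewrite mulrACA -exprD -polyCM coefCM coefXn eq_sym mnk // (negPf P'i) mulr0.
Qed.

(** * Partition vectors as diagrams *)

Section PartitionSeq.
Variables L W : nat.
Implicit Types v : vec L W.

Definition partition_seq v : seq nat :=
  take (find (pred1 0%N) (mkseq (part_at v) L.+1)) (mkseq (part_at v) L.+1).

Lemma nth_partition_seq v i : is_partition v ->
  nth 0%N (partition_seq v) i = part_at v i.
Proof.
move=> pv; rewrite /partition_seq; set s := mkseq _ _.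
have ss : size s = L.+1 by rewrite size_mkseq.
case: (ltnP i (find (pred1 0%N) s)) => il.
  have iL : (i < L.+1)%N by rewrite -ss; apply: leq_trans il (find_size _ _).
  by rewrite nth_take // nth_mkseq.
rewrite nth_default ?size_take_min; last by rewrite geq_min il.
case: (leqP i L) => iL; last by rewrite part_at_large.
have fL : (find (pred1 0%N) s < L.+1)%N by apply: leq_ltn_trans il _.
have := @nth_find _ 0%N (pred1 0%N) s; rewrite has_find ss fL => /(_ isT) /=.
rewrite nth_mkseq // => /eqP f0; apply/esym/eqP; rewrite -leqn0 -f0.
exact: part_at_le_trans.
Qed.

Lemma partition_seq_diagram v : is_partition v -> is_diagram (partition_seq v).
Proof.
move=> pv; apply/andP; split.
  apply/(sortedP 0%N) => i _ /=; rewrite !nth_partition_seq //.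
  exact: (is_partitionP _ pv).
apply/negP => /(nthP 0%N)[i]; rewrite size_take_min leq_min => /andP[il _].
rewrite /partition_seq nth_take // => i0; have := before_find 0%N il.
by rewrite i0 /= eqxx.
Qed.

Lemma size_partition_seq v : (size (partition_seq v) <= L.+1)%N.
Proof. by rewrite size_take_min size_mkseq geq_minr. Qed.

Lemma eq_diagram la la' : is_diagram la -> is_diagram la' ->
  (forall i, nth 0%N la i = nth 0%N la' i) -> la = la'.
Proof.
suff le la1 la2 : is_diagram la1 -> (forall i, nth 0%N la1 i = nth 0%N la2 i) ->
    (size la1 <= size la2)%N.
  move=> dla dla' e; apply: (@eq_from_nth _ 0%N) => //.
  by apply/eqP; rewrite eqn_leq !le.
move=> /andP[_ la0] e; rewrite leqNgt; apply: contra la0 => lt.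
by apply/(nthP 0%N); exists (size la2) => //; rewrite e nth_default.
Qed.

Lemma seq_vec_partition_seq v : is_partition v -> part_at v 0 = W ->
  seq_vec L W (partition_seq v) = v.
Proof.
move=> pv vW; apply: eq_part_at => i; rewrite part_at_seq_vec.
- exact: nth_partition_seq.
- exact: partition_seq_diagram.
- by rewrite /first_row nth_partition_seq.
- exact: size_partition_seq.
Qed.

(** This turns the sum over infinitely many diagrams into a finite one: diagrams of width [W] with
    at most [L.+1] rows are the partition vectors with first part [W]. *)
Lemma sum_diagrams (V : nmodType) (G : seq nat -> V) :
  (forall la, is_diagram la -> (L.+1 < size la)%N -> G la = 0) ->
  \sum_(la \in [set la | is_diagram la /\ first_row la = W]%classic) G la
  = \sum_(v : vec L W | is_partition v && (part_at v 0 == W)) G (partition_seq v).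
Proof.
move=> G0; pose D := [set la | [/\ is_diagram la, first_row la = W &
  (size la <= L.+1)%N]]%classic.
rewrite -(@fsbig_widen _ _ _ _ D); first last.
- move=> la [[/= dla laW] nD]; apply: G0 => //; rewrite ltnNge.
  by apply/negP => h; case: nD.
- by move=> la [].
rewrite -(fsum_finite (fun v : vec L W => is_partition v && (part_at v 0 == W))
  (fun v => G (partition_seq v))).
apply: reindex_fsbig; split=> [v /= /andP[pv /eqP vW]|v v'|la [dla laW laL]].
- split; [exact: partition_seq_diagram| |exact: size_partition_seq].
  by rewrite /first_row nth_partition_seq.
- rewrite !inE => /andP[pv _] /andP[pv' _] e; apply: eq_part_at => i.
  by rewrite -!nth_partition_seq // e.
- have pv := is_partition_seq_vec dla laW laL.
  exists (seq_vec L W la) => /=.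
    by apply/andP; split; [exact: pv|apply/eqP; rewrite part_at_seq_vec].
  apply: eq_diagram => // [|i]; first exact: partition_seq_diagram.
  by rewrite nth_partition_seq // part_at_seq_vec.
Qed.

End PartitionSeq.

(** * The theorem's coefficients read off from chain sums *)

Section Substitution.
Variables (L W N B : nat) (a b : monomial).
Hypothesis aN : forall k, k \in finsupp a -> (k < N)%N.
Hypothesis bN : forall k, k \in finsupp b -> (k < N)%N.
Hypothesis gridB : (#|grid L W| < B)%N.
Hypotheses (aB : forall k, (a k < B)%N) (bB : forall k, (b k < B)%N).
Hypothesis aL : (\sum_(k <- finsupp a) a k <= L)%N.

Local Notation xs := (kronecker_vars B 0 N).
Local Notation ys := (kronecker_vars B N N).
Local Notation exponent := (kronecker B (contents N a ++ contents N b)).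

Lemma contents_small (c : monomial) : (forall k, (c k < B)%N) ->
  all (fun d => d < B)%N (contents N c).
Proof. by move=> cB; apply/allP => _ /mapP[i _ ->]. Qed.

Lemma stats_small (e : {set grid L W} -> nat) (t : seq {set grid L W}) :
  (forall U, (e U <= #|grid L W|)%N) -> all (fun d => d < B)%N (map e t).
Proof.
by move=> eg; apply/allP => _ /mapP[U _ ->]; apply: leq_ltn_trans (eg U) gridB.
Qed.

(** The level statistics are at most the size of the grid and the prescribed contents are below [B],
    so all are genuine base-[B] digits. Equality of exponents is then equality of all x- and
    y-contents. *)
Lemma coef_chains (z : {poly int}) (v : vec L W) :
  is_partition v -> part_at v 0 = W ->
  (up_chain z%:P xs v * down_chain z%:P ys v (fun=> 1))`_exponent
  = grothendieck_at z (partition_seq v) a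
    * dual_grothendieck_at z (partition_seq v) b.
Proof.
move=> pv vW; have dla := partition_seq_diagram pv.
have laW : first_row (partition_seq v) = W by rewrite /first_row nth_partition_seq.
have laL := size_partition_seq v.
rewrite (grothendieck_at_levels dla laW laL z aN).
rewrite (dual_grothendieck_at_levels dla laW laL z bN).
rewrite -level_sum_svt // -level_sum_rpp //.
rewrite !(level_sum_size _ _ _ _ _ (size_kronecker_vars _ _ _)).
rewrite /level_tuples seq_vec_partition_seq //.
pose e1 (U : {set grid L W}) := #|U|.
pose e2 (U : {set grid L W}) := #|columns U|.
pose f1 (U A : {set grid L W}) := (- z) ^+ #|U :&: A|.
pose f2 (U A : {set grid L W}) := z ^+ #|repeats U|.
rewrite (eq_bigr (fun t : N.-tuple {set grid L W} => (coeff f1 t)%:P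
   * 'X^(kronecker B (map e1 t)))); last first.
  move=> t _; rewrite mon_kronecker ?size_tuple // expn0 mul1n; congr (_ * _).
  by apply: coeff_polyC => U A; rewrite /f1 rmorphXn /= polyCN.
rewrite [X in _ * X](eq_bigr (fun t : N.-tuple {set grid L W} =>
   (coeff f2 t)%:P * 'X^(B ^ N * kronecker B (map e2 t)))); last first.
  move=> t _; rewrite mon_kronecker ?size_tuple //; congr (_ * _).
  by apply: coeff_polyC => U A; rewrite /f2 rmorphXn.
rewrite (@coef_mul_sums _ _ _ _ _ _ _ _ _
  (fun t : N.-tuple {set grid L W} => map e1 t == contents N a)
  (fun t : N.-tuple {set grid L W} => map e2 t == contents N b)).
  by congr (_ * _); apply: eq_bigl => t; rewrite -andbA.
move=> t t' _ _ /=.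
have sz (e : {set grid L W} -> nat) (u : N.-tuple {set grid L W}) (c : monomial) :
    size (map e u) = size (contents N c).
  by rewrite size_map size_tuple size_mkseq.
have -> : (kronecker B (map e1 t) + B ^ N * kronecker B (map e2 t')
           = kronecker B (map e1 t ++ map e2 t'))%N.
  by rewrite kronecker_cat size_map size_tuple.
rewrite -eqseq_cat //; apply/eqP/eqP => [|->//]; apply: kronecker_inj.
- by rewrite !size_cat (sz _ _ a) (sz _ _ b).
- rewrite all_cat !stats_small // => U; last exact: max_card.
  by apply: leq_trans (leq_imset_card _ _) (max_card _).
- by rewrite all_cat !contents_small.
Qed.

(** Every box holds a letter and every row has a box, so a long diagram needs a larger degree than
    that of x^a. *)
Lemma grothendieck_at_large z la : is_diagram la -> (L.+1 < size la)%N ->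
  grothendieck_at z la a = 0.
Proof.
move=> /andP[_ la0] laL; apply: fsbig1 => P [[/= P0 _ _] Pw]; exfalso.
have := @card_box_le la (fun b k => k \in P b) a
  (fun b => fset0Pn _ (P0 b)) Pw.
rewrite leqNgt => /negP; apply; apply: leq_ltn_trans aL _.
apply: leq_trans (ltnW laL) _.
elim: la la0 {laL P P0 Pw} => //= d la IH; rewrite inE negb_or => /andP[d0 /IH].
by rewrite -add1n; apply: leq_add; rewrite lt0n eq_sym.
Qed.

Definition first_part_indicator (l : seq nat) : {poly {poly int}} :=
  (head 0%N l == W)%:R.

Lemma sum_diagrams_coef z :
  sum2 [set la | is_diagram la /\ first_row la = W]%classic
    (fun la => mul2 (in_x (grothendieck_at z la))
                    (in_y (dual_grothendieck_at z la))) a b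
  = (\sum_(v : vec L W | is_partition v)
      up_chain z%:P xs v * down_chain z%:P ys v first_part_indicator)`_exponent.
Proof.
rewrite /sum2 (sum_diagrams (L := L)); last first.
  by move=> la dla laL; rewrite mul2_in_x_in_y grothendieck_at_large // mul0r.
rewrite coef_sum big_mkcondr /=; apply: eq_bigr => v pv.
have -> : down_chain z%:P ys v first_part_indicator
          = down_chain z%:P ys v (fun=> 1) * (part_at v 0 == W)%:R.
  (* Linearity over a one-term sum pulls the scalar out of the functional, since along chains from
     [v] the first entry is always [part_at v 0]. *)
  have := down_chain_sum z%:P ys v [:: tt] (fun _ _ => 1)
    (fun=> (part_at v 0 == W)%:R).
  rewrite [X in _ = X]big_seq1 => <-; apply: eq_down_chain => l.
  by rewrite big_seq1 mul1r.
case: eqP => vW; last by rewrite !mulr0 coef0.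
by rewrite mulr1 coef_chains // mul2_in_x_in_y.
Qed.

Lemma sum_diagrams_indep z z' : (N <= L)%N ->
  sum2 [set la | is_diagram la /\ first_row la = W]%classic
    (fun la => mul2 (in_x (grothendieck_at z la))
                    (in_y (dual_grothendieck_at z la))) a b
  = sum2 [set la | is_diagram la /\ first_row la = W]%classic
    (fun la => mul2 (in_x (grothendieck_at z' la))
                    (in_y (dual_grothendieck_at z' la))) a b.
Proof.
move=> NL; apply: etrans (sum_diagrams_coef z) _.
apply: etrans (esym (sum_diagrams_coef z')).
apply: (congr1 (fun p : {poly {poly int}} => p`_exponent)).
by apply: up_down_chain_indep; rewrite ?kronecker_vars_neq0 ?size_kronecker_vars.
Qed.

End Substitution.

Local Open Scope classical_set_scope.

Theorem mainTheorem2 (w : nat) :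
  sum2 [set la | is_diagram la /\ first_row la = w]
       (fun la => mul2 (in_x (grothendieck la)) (in_y (dual_grothendieck la)))
  = sum2 [set la | is_diagram la /\ first_row la = w]
       (fun la => mul2 (in_x (schur la)) (in_y (schur la))).
Proof.
apply/funext => a; apply/funext => b.
(* An index in a support is at most the sum of that support, so [N] letters cover both monomials. *)
pose N := (\sum_(k <- finsupp a) k + \sum_(k <- finsupp b) k).+1.
pose A (c : monomial) := (\sum_(k <- finsupp c) c k)%N.
(* The summand [N] keeps row [L] out of reach of [N] up steps; [A a] makes longer diagrams
   vanish. *)
pose L := (N + A a)%N.
pose B := (#|grid L w| + A a + A b).+1.
have bound (c : monomial) k : (c k <= A c)%N.
  have [kc|/fsfun_dflt->//] := boolP (k \in finsupp c).
  by rewrite /A (bigD1_seq k) ?fset_uniq //= leq_addr.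
have supp (c : monomial) k : k \in finsupp c -> (k <= \sum_(k <- finsupp c) k)%N.
  by move=> kc; rewrite (bigD1_seq k) ?fset_uniq //= leq_addr.
have aN k : k \in finsupp a -> (k < N)%N.
  by move=> /supp ka; rewrite ltnS; apply: leq_trans ka (leq_addr _ _).
have bN k : k \in finsupp b -> (k < N)%N.
  by move=> /supp ka; rewrite ltnS; apply: leq_trans ka (leq_addl _ _).
have gridB : (#|grid L w| < B)%N by rewrite ltnS -addnA leq_addr.
have aB k : (a k < B)%N by have := bound a k; rewrite /B; lia.
have bB k : (b k < B)%N by have := bound b k; rewrite /B; lia.
have aL : (A a <= L)%N by rewrite leq_addl.
transitivity (sum2 [set la | is_diagram la /\ first_row la = w]
  (fun la => mul2 (in_x (grothendieck_at 0 la))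
                  (in_y (dual_grothendieck_at 0 la))) a b).
  (* The families of the statement are, by definition, those at the parameter ['X]. *)
  exact: (sum_diagrams_indep aN bN gridB aB bB aL 'X 0 (leq_addr _ _)).
apply: eq_fsbigr => la; rewrite inE => -[/= dla _].
by rewrite grothendieck_at0 dual_grothendieck_at0.
Qed.
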